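(* Let $f$ be a holomorphic map defined in a neighborhood of $0\in\mathbb{C}$ with expansion $$f(z)=z+z^2+z^3+O(z^4).$$ For $n\ge 0$ define $$\phi_n(z):=f^n\left(\frac{z}{1+nz}\right).$$ Then for all sufficiently small $\epsilon>0$, the maps $\phi_n$ are defined on $V_\epsilon=\{z\in\mathbb{C} : |z-\epsilon|<\epsilon\}$ and converge there to a map $\phi$ which is a parametrization of the unstable manifold of $f$; in particular $$\phi\left(\frac{t}{1-t}\right)=f(\phi(t))$$ for all $t\in V_\epsilon$ with $\frac{t}{1-t}\in V_\epsilon$. Moreover, there is a constant $C'>0$ such that for every $z\in V_\epsilon$ and every $n\ge 1$, $$|\phi_{n+1}(z)-\phi_n(z)|<\frac{C'|z|^2}{(1+n|z|)^2}<\frac{C'}{n^2}.$$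
   Context: $f^n$ denotes the $n$-th iterate of $f$. The unstable manifold of such an $f$ is the region of points near $0$ whose orbits under the local inverse $f^{-1}$ (defined near $0$) converge to $0$. A parametrization of the unstable manifold of $f$ on $V_\epsilon$ is an injective holomorphic map $\phi:V_\epsilon\to\mathbb{C}$ with image contained in the unstable manifold of $f$ and satisfying $\phi\left(\frac{t}{1-t}\right)=f(\phi(t))$ whenever $t$ and $\frac{t}{1-t}$ both lie in $V_\epsilon$. *)

(* Defs.v *)
From Stdlib Require Import Reals.
From Coquelicot Require Import Coquelicot.

Local Open Scope C_scope.

(** A partially defined map is a total function [f : C -> C] together with its
    domain [U]; values of [f] outside [U] carry no meaning, so a statement that
    applies [f] at a point also asserts that the point lies in [U]. *)

Definition holomorphic_on (U : C -> Prop) (f : C -> C) : Prop :=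
  forall z : C, U z -> ex_derive (K := C_AbsRing) (V := C_NormedModule) f z.

Definition V (eps : R) (z : C) : Prop := (Cmod (z - RtoC eps) < eps)%R.

(** [g] is a local inverse of [f : U -> C] at the fixed point 0, with domain
    the neighbourhood [W] of 0. *)
Record local_inverse (U : C -> Prop) (f : C -> C)
    (W : C -> Prop) (g : C -> C) : Prop := {
  local_inverse_open : open W;
  local_inverse_mem0 : W 0;
  local_inverse_fix0 : g 0 = 0;
  local_inverse_holomorphic : holomorphic_on W g;
  local_inverse_right : forall w : C, W w -> U (g w) /\ f (g w) = w;
  local_inverse_left : locally (0 : C) (fun z : C => g (f z) = z)
}.

(** The unstable manifold is that of the map whose local inverse is
    [g : W -> C]: points all of whose iterates under [g] are defined and
    converge to 0. *)
Definition unstable_manifold (W : C -> Prop) (g : C -> C) (p : C) : Prop :=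
  (forall n : nat, W (Nat.iter n g p)) /\
  filterlim (fun n : nat => Nat.iter n g p) eventually (locally (0 : C)).

(** Only the values of [phi] on [V eps] matter. *)
Record unstable_parametrization (U : C -> Prop) (f : C -> C)
    (W : C -> Prop) (g : C -> C) (eps : R) (phi : C -> C) : Prop := {
  parametrization_holomorphic : holomorphic_on (V eps) phi;
  parametrization_injective :
    forall s t : C, V eps s -> V eps t -> phi s = phi t -> s = t;
  parametrization_image :
    forall t : C, V eps t -> unstable_manifold W g (phi t);
  parametrization_conjugacy :
    forall t : C, V eps t -> V eps (t / (1 - t)) ->
      U (phi t) /\ phi (t / (1 - t)) = f (phi t)
}.

Definition phi_ (f : C -> C) (n : nat) (z : C) : C :=
  Nat.iter n f (z / (1 + RtoC (INR n) * z)).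

Definition phi_defined_at (U : C -> Prop) (f : C -> C) (n : nat) (z : C) : Prop :=
  1 + RtoC (INR n) * z <> 0 /\
  forall k : nat, (k < n)%nat ->
    U (Nat.iter k f (z / (1 + RtoC (INR n) * z))).

(* Main.v *)
Require Import Defs.
From Stdlib Require Import Reals Lra Lia ClassicalEpsilon.
From Coquelicot Require Import Coquelicot.

(** In the coordinate [w = 1 / z] the disk [V eps] is the half-plane
    [Re w > 1 / (2 * eps)], the map [f] becomes
    [F w = 1 / f (1 / w) = w - 1 + O(1 / |w|^2)] (the coefficient of [z^3] is
    exactly the one that cancels the [1 / w] term), and [phi_ f n] becomes
    [w |-> F^n (w + n)].  Write [Phi_n] for this map; it satisfies
    [Phi_(n+1) w = F (Phi_n (w + 1))], so every bound below is an induction on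
    [n] that moves one unit to the right in the half-plane.

    The defect [F w - (w - 1)] is summable along the orbits, so [Phi_n] stays at
    distance at most 1/2 from the identity; this keeps all orbits in the domain.
    The defect is also Lipschitz with constant [O(1 / x^2)] on [Re w >= x], by
    Cauchy's estimate, so the Lipschitz constants of the [Phi_n] form a convergent
    product.  Hence the initial discrepancy
    [Phi_1 w - w = O(1 / |w + 1|^2)] is propagated as
    [Phi_(n+1) w - Phi_n w = O(1 / |w + n + 1|^2)]
    ([conjugate_iterate_step]), which is the claimed speed of convergence, and
    the limit [Phi] is holomorphic, close enough to the identity to be injective,
    and satisfies [Phi w = F (Phi (w + 1))] ([conjugation_to_translation]).  This
    equation gives both the conjugacy and the backward orbit: any local inverse
    sends [1 / Phi w] to [1 / Phi (w + 1)], so the orbit of [1 / Phi w] is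
    [1 / Phi (w + n)], which tends to 0.

    Holomorphy is here mere pointwise complex differentiability, and three of its
    consequences are needed: the Cauchy estimate for the derivative, the fact that
    a uniform limit of holomorphic functions is holomorphic, and the existence of
    a holomorphic local inverse.  They all come from one maximum principle
    ([max_principle]) for functions that are holomorphic off the centre of a disk
    and merely continuous at the centre.  Pulling such a function back by [exp]
    gives a periodic function on a half-plane; Goursat's bisection argument shows
    that its mean over a period does not depend on the abscissa, and the mean
    tends to the central value as the abscissa tends to minus infinity.  Applying the
    principle to the difference quotient [(h (a + z) - h a) / z] yields the
    Cauchy estimate, and applying that estimate to [h (z + s) - h (a + s)] shows
    that [h'] is Lipschitz, which is the uniform second-order control
    under which derivatives pass to the limit. *)

Local Open Scope C_scope.

(** * Complex derivatives and limits in terms of the modulus *)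

(** The type annotations fix the normed module structure on [C], for which
    unification has several candidates. *)
Definition is_cderive (f : C -> C) (z l : C) : Prop :=
  is_derive (K := C_AbsRing) (V := C_NormedModule) f z l.

Lemma locally_C_Cmod (x : C) (P : C -> Prop) :
  locally x P <->
  exists d : R, (0 < d)%R /\ forall y, (Cmod (y - x) < d)%R -> P y.
Proof.
  split.
  - intros H. apply locally_C in H. destruct H as [d Hd].
    exists d. split; [apply cond_pos | intros y Hy; apply Hd; exact Hy].
  - intros [d [Hd H]]. apply locally_C. exists (mkposreal d Hd).
    intros y Hy. apply H, Hy.
Qed.

Lemma filterlim_C_Cmod (u : nat -> C) (l : C) :
  filterlim u eventually (locally l) <->
  forall eps, (0 < eps)%R ->
    exists N, forall n, (N <= n)%nat -> (Cmod (u n - l) < eps)%R.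
Proof.
  split.
  - intros H eps Heps.
    destruct (H (fun y => Cmod (y - l) < eps)%R) as [N HN].
    + apply locally_C_Cmod. exists eps. tauto.
    + exists N. exact HN.
  - intros H P HP. apply locally_C_Cmod in HP. destruct HP as [d [Hd HP]].
    destruct (H d Hd) as [N HN]. exists N. intros n Hn. apply HP, HN, Hn.
Qed.

Lemma is_cderive_Cmod (f : C -> C) (z l : C) :
  is_cderive f z l <->
  forall eps, (0 < eps)%R -> exists d, (0 < d)%R /\
    forall w, (Cmod (w - z) < d)%R ->
      (Cmod (f w - f z - l * (w - z)) <= eps * Cmod (w - z))%R.
Proof.
  split.
  - intros [_ H] eps Heps.
    assert (H' := H z (fun P HP => HP) (mkposreal eps Heps)).
    destruct H' as [d Hd]. exists d. split; [apply cond_pos|].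
    intros w Hw. specialize (Hd w Hw).
    replace (f w - f z - l * (w - z)) with (f w - f z - (w - z) * l) by ring.
    exact Hd.
  - intros H. split.
    + apply is_linear_scal_l.
    + intros x Hx. apply (is_filter_lim_locally_unique (V := AbsRing_NormedModule C_AbsRing)) in Hx. subst x.
      intros eps. destruct (H eps (cond_pos eps)) as [d [Hd Hw]].
      exists (mkposreal d Hd). intros w Hw'. specialize (Hw w Hw').
      replace (f w - f z - l * (w - z)) with (f w - f z - (w - z) * l) in Hw by ring.
      exact Hw.
Qed.

Lemma holomorphic_on_is_cderive (U : C -> Prop) (f : C -> C) :
  holomorphic_on U f <-> forall z, U z -> exists l, is_cderive f z l.
Proof. split; intros H z Hz; exact (H z Hz). Qed.

Lemma is_cderive_const (c z : C) : is_cderive (fun _ => c) z 0.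
Proof. apply (is_derive_const (K:=C_AbsRing) (V:=C_NormedModule)). Qed.

Lemma is_cderive_id (z : C) : is_cderive (fun w => w) z 1.
Proof. apply is_cderive_Cmod. intros eps He. exists 1%R. split; [lra|]. intros w _.
  replace (w - z - 1 * (w - z)) with (RtoC 0) by ring. rewrite Cmod_0.
  apply Rmult_le_pos; [lra|apply Cmod_ge_0]. Qed.

Lemma is_cderive_plus (f g : C -> C) (z df dg : C) :
  is_cderive f z df -> is_cderive g z dg ->
  is_cderive (fun w => f w + g w) z (df + dg).
Proof. apply (is_derive_plus (K:=C_AbsRing) (V:=C_NormedModule)). Qed.

Lemma is_cderive_minus (f g : C -> C) (z df dg : C) :
  is_cderive f z df -> is_cderive g z dg ->
  is_cderive (fun w => f w - g w) z (df - dg).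
Proof. apply (is_derive_minus (K:=C_AbsRing) (V:=C_NormedModule)). Qed.

Lemma is_cderive_comp (f g : C -> C) (z df dg : C) :
  is_cderive f (g z) df -> is_cderive g z dg ->
  is_cderive (fun w => f (g w)) z (dg * df).
Proof.
  intros Hf Hg. 
  assert (Hg' : is_derive (K:=C_AbsRing) (V:=AbsRing_NormedModule C_AbsRing) g z dg).
  { split. apply is_linear_scal_l. intros x Hx.
    destruct Hg as [_ Hg]. intros eps. specialize (Hg x Hx eps). exact Hg. }
  exact (is_derive_comp (K:=C_AbsRing) (V:=C_NormedModule) f g z df dg Hf Hg').
Qed.

Lemma is_cderive_mult (f g : C -> C) (z df dg : C) :
  is_cderive f z df -> is_cderive g z dg ->
  is_cderive (fun w => f w * g w) z (df * g z + f z * dg).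
Proof.
  intros Hf Hg.
  assert (B : forall h dh, is_cderive h z dh -> is_derive (K:=C_AbsRing) (V:=AbsRing_NormedModule C_AbsRing) h z dh).
  { intros h dh Hh. split. apply is_linear_scal_l. intros x Hx.
    destruct Hh as [_ Hh]. intros eps. specialize (Hh x Hx eps). exact Hh. }
  assert (H := is_derive_mult (K:=C_AbsRing) f g z df dg (B _ _ Hf) (B _ _ Hg) Cmult_comm).
  split. apply is_linear_scal_l. intros x Hx.
    destruct H as [_ H]. intros eps. specialize (H x Hx eps). exact H.
Qed.

Lemma is_cderive_cont (f : C -> C) (z l : C) :
  is_cderive f z l ->
  forall eps, (0 < eps)%R -> exists d, (0 < d)%R /\
    forall w, (Cmod (w - z) < d)%R -> (Cmod (f w - f z) < eps)%R.
Proof.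
  intros H eps He.
  destruct (proj1 (is_cderive_Cmod f z l) H 1%R Rlt_0_1) as [d [Hd Hw]].
  assert (H0 := Cmod_ge_0 l).
  assert (0 < eps / (Cmod l + 2))%R by (apply Rdiv_lt_0_compat; lra).
  exists (Rmin d (eps / (Cmod l + 2))). split; [apply Rmin_pos; lra|].
  intros w Hwd.
  assert (Hwd1 := Rlt_le_trans _ _ _ Hwd (Rmin_l _ _)).
  assert (Hwd2 := Rlt_le_trans _ _ _ Hwd (Rmin_r _ _)).
  specialize (Hw w Hwd1).
  replace (f w - f z) with ((f w - f z - l * (w - z)) + l * (w - z)) by ring.
  eapply Rle_lt_trans; [apply Cmod_triangle|].
  rewrite Cmod_mult.
  apply (Rmult_lt_compat_l (Cmod l + 2)) in Hwd2; [|lra].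
  replace ((Cmod l + 2) * (eps / (Cmod l + 2)))%R with eps in Hwd2 by (field; lra).
  assert (Hm := Cmod_ge_0 (w - z)). nra.
Qed.

Lemma is_cderive_inv (z : C) : z <> 0 -> is_cderive Cinv z (- / (z * z)).
Proof.
  intros Hz. apply is_cderive_Cmod. intros eps He.
  assert (Hz' := proj1 (Cmod_gt_0 z) Hz).
  set (r := Cmod z) in *.
  assert (0 < eps * r ^ 3 / 2)%R.
  { assert (0 < r ^ 3)%R by (apply pow_lt; lra). nra. }
  exists (Rmin (r / 2) (eps * r ^ 3 / 2)). split; [apply Rmin_pos; lra|].
  intros w Hw.
  assert (Hw1 := Rlt_le_trans _ _ _ Hw (Rmin_l _ _)).
  assert (Hw2 := Rlt_le_trans _ _ _ Hw (Rmin_r _ _)).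
  assert (Hwr : (r / 2 < Cmod w)%R).
  { assert (Ht := Cmod_triangle w (z - w)). replace (w + (z - w)) with z in Ht by ring.
    fold r in Ht. rewrite <- (Cmod_opp (z - w)) in Ht.
    replace (- (z - w)) with (w - z) in Ht by ring. lra. }
  assert (Hw0 : w <> 0) by (apply Cmod_gt_0; lra).
  replace (/ w - / z - - / (z * z) * (w - z)) with ((w - z) * (w - z) * / (w * z * z)).
  2:{ field. auto. }
  rewrite !Cmod_mult, Cmod_inv, !Cmod_mult by (repeat apply Cmult_neq_0; auto).
  fold r. assert (H1 := Cmod_ge_0 (w - z)).
  rewrite (Rmult_comm eps), Rmult_assoc. apply Rmult_le_compat_l; [exact H1|].
  apply (Rmult_le_reg_r (Cmod w * r * r)).
  { repeat apply Rmult_lt_0_compat; lra. }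
  rewrite Rmult_assoc, Rinv_l, Rmult_1_r.
  2:{ repeat apply Rmult_integral_contrapositive_currified; lra. }
  apply Rle_trans with (eps * r ^ 3 / 2)%R; [lra|].
  replace (eps * (Cmod w * r * r))%R with (eps * r * r * Cmod w)%R by ring.
  replace (eps * r ^ 3 / 2)%R with (eps * r * r * (r / 2))%R by field.
  apply Rmult_le_compat_l; [|lra]. repeat apply Rmult_le_pos; lra.
Qed.

Lemma Cmod_Im_le (z : C) : (Rabs (Im z) <= Cmod z)%R.
Proof. destruct z as [x y]. eapply Rle_trans; [|apply Rmax_Cmod]. apply Rmax_r. Qed.

Lemma Cmod_le_ReIm (z : C) : (Cmod z <= Rabs (Re z) + Rabs (Im z))%R.
Proof.
  destruct z as [x y]. simpl.
  replace (x, y) with (RtoC x + Ci * RtoC y) by (apply injective_projections; simpl; ring).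
  eapply Rle_trans; [apply Cmod_triangle|].
  rewrite Cmod_mult, !Cmod_R, Cmod_Ci. lra.
Qed.

Lemma Cmod_minus_sym (z w : C) : Cmod (z - w) = Cmod (w - z).
Proof. rewrite <- Cmod_opp. f_equal. ring. Qed.

Lemma Cmod_minus_triangle (a b c : C) : (Cmod (a - c) <= Cmod (a - b) + Cmod (b - c))%R.
Proof. replace (a - c) with ((a - b) + (b - c)) by ring. apply Cmod_triangle. Qed.

Lemma Cmod_triangle_minus (z w : C) : (Cmod (z - w) <= Cmod z + Cmod w)%R.
Proof. rewrite <- (Cmod_opp w). apply Cmod_triangle. Qed.

Lemma telescoping_dist (u : nat -> C) (b : nat -> R) :
  (forall n, Cmod (u (S n) - u n) <= b n - b (S n))%R ->
  forall n k, (Cmod (u (n + k)%nat - u n) <= b n - b (n + k)%nat)%R.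
Proof.
  intros H n k. induction k as [|k IH].
  - rewrite Nat.add_0_r. replace (u n - u n) with (RtoC 0) by ring. rewrite Cmod_0. lra.
  - rewrite Nat.add_succ_r.
    assert (H1 := Cmod_minus_triangle (u (S (n + k))) (u (n + k)%nat) (u n)).
    specialize (H (n + k)%nat). lra.
Qed.

(** Summability of the increments with explicit tails: [b n] plays the role of
    the sum of the increments from rank [n] on, so it also bounds the distance to
    the limit.  All limits below are obtained in this form, which keeps the error
    bounds uniform in a parameter. *)
Lemma telescoping_limit (u : nat -> C) (b : nat -> R) :
  (forall n, Cmod (u (S n) - u n) <= b n - b (S n))%R ->
  is_lim_seq b 0 ->
  exists l, forall n, (Cmod (u n - l) <= b n)%R.
Proof.
  intros Hu Hb.
  assert (Hd := telescoping_dist u b Hu).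
  assert (Hb0 : forall n, (0 <= b n)%R).
  { intros n. 
    assert (Hle : Rbar_le 0 (b n)); [|exact Hle].
    apply (is_lim_seq_le (fun k => b (k + n)%nat) (fun _ => b n) 0 (b n)).
    - intros k. assert (H := Hd n k). rewrite Nat.add_comm in H. 
      assert (H1 := Cmod_ge_0 (u (k + n)%nat - u n)). lra.
    - apply is_lim_seq_incr_n. exact Hb.
    - apply is_lim_seq_const. }
  assert (HC : forall n m, (Cmod (u n - u m) <= Rmax (b n) (b m))%R).
  { assert (HC' : forall n k, (Cmod (u (n + k)%nat - u n) <= b n)%R).
    { intros n k. assert (H := Hd n k). assert (H1 := Hb0 (n + k)%nat). lra. }
    intros n m. destruct (Nat.le_ge_cases n m) as [L|L].
    - rewrite Cmod_minus_sym. replace m with (n + (m - n))%nat by lia.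
      eapply Rle_trans; [apply HC'|apply Rmax_l].
    - replace n with (m + (n - m))%nat by lia.
      eapply Rle_trans; [apply HC'|apply Rmax_r]. }
  assert (HN : forall eps : posreal, exists N, forall n, (N <= n)%nat -> (b n < eps)%R).
  { intros eps. destruct (proj1 (is_lim_seq_Reals b 0) Hb eps (cond_pos eps)) as [N HN].
    exists N. intros n Hn. specialize (HN n Hn). unfold R_dist in HN.
    rewrite Rminus_0_r in HN. apply Rabs_def2 in HN. lra. }
  assert (E : forall p : C -> R, (forall z w : C, p (z - w)%C = p z - p w)%R ->
     (forall z, Rabs (p z) <= Cmod z)%R -> ex_finite_lim_seq (fun n => p (u n))).
  { intros p Hp Hpm. apply ex_lim_seq_cauchy_corr. intros eps.
    destruct (HN eps) as [N H]. exists N. intros n m Hn Hm.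
    change (Rabs (p (u n) - p (u m)) < eps)%R. rewrite <- Hp. eapply Rle_lt_trans; [apply Hpm|].
    eapply Rle_lt_trans; [apply HC|]. apply Rmax_lub_lt; apply H; assumption. }
  destruct (E Re) as [lx Hx]; [reflexivity|apply re_le_Cmod|].
  destruct (E Im) as [ly Hy]; [reflexivity|apply Cmod_Im_le|].
  exists (lx, ly). intros n. apply le_epsilon. intros eps He.
  apply is_lim_seq_Reals in Hx. apply is_lim_seq_Reals in Hy.
  destruct (Hx (eps / 2)%R) as [N1 H1]; [lra|].
  destruct (Hy (eps / 2)%R) as [N2 H2]; [lra|].
  set (m := Nat.max n (Nat.max N1 N2)).
  assert (H3 := Cmod_minus_triangle (u n) (u m) (lx, ly)).
  assert (H4 := Hd n (m - n)%nat). replace (n + (m - n))%nat with m in H4 by lia.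
  rewrite Cmod_minus_sym in H4.
  assert (H5 := Cmod_le_ReIm (u m - (lx, ly))).
  specialize (H1 m ltac:(lia)). specialize (H2 m ltac:(lia)).
  unfold R_dist in H1, H2. 
  change (Re (u m - (lx, ly))) with (Re (u m) - lx)%R in H5.
  change (Im (u m - (lx, ly))) with (Im (u m) - ly)%R in H5.
  specialize (Hb0 m). lra.
Qed.

(** * Additive functions of rectangles *)

(** Componentwise, so that integrability and additivity reduce to those of
    real integrals. *)
Definition CInt (f : R -> C) (a b : R) : C :=
  (RInt (fun t => Re (f t)) a b, RInt (fun t => Im (f t)) a b).

Definition ex_CInt (f : R -> C) (a b : R) : Prop :=
  ex_RInt (fun t => Re (f t)) a b /\ ex_RInt (fun t => Im (f t)) a b.

Lemma CInt_Chasles (f : R -> C) (a b c : R) :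
  ex_CInt f a b -> ex_CInt f b c -> CInt f a c = CInt f a b + CInt f b c.
Proof.
  intros [H1 H2] [H3 H4]. unfold CInt.
  rewrite <- (RInt_Chasles (fun t => Re (f t)) a b c) by assumption.
  rewrite <- (RInt_Chasles (fun t => Im (f t)) a b c) by assumption.
  reflexivity.
Qed.

Lemma CInt_plus_ext (f g h : R -> C) (a b : R) :
  ex_CInt f a b -> ex_CInt g a b -> (forall t, h t = f t + g t) ->
  CInt h a b = CInt f a b + CInt g a b.
Proof.
  intros [H1 H2] [H3 H4] Hh. unfold CInt.
  rewrite (RInt_ext (fun t => Re (h t)) (fun t => Re (f t) + Re (g t))%R) by (intros; rewrite Hh; reflexivity).
  rewrite (RInt_ext (fun t => Im (h t)) (fun t => Im (f t) + Im (g t))%R) by (intros; rewrite Hh; reflexivity).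
  rewrite (RInt_plus (V := R_CompleteNormedModule) (fun t => Re (f t)) (fun t => Re (g t))) by assumption.
  rewrite (RInt_plus (V := R_CompleteNormedModule) (fun t => Im (f t)) (fun t => Im (g t))) by assumption.
  reflexivity.
Qed.

Lemma CInt_0_ext (f : R -> C) (a b : R) :
  (forall t, f t = 0) -> CInt f a b = 0.
Proof.
  intros Hf. unfold CInt.
  rewrite (RInt_ext (fun t => Re (f t)) (fun t => 0%R)) by (intros; rewrite Hf; reflexivity).
  rewrite (RInt_ext (fun t => Im (f t)) (fun t => 0%R)) by (intros; rewrite Hf; reflexivity).
  rewrite !RInt_const. apply injective_projections; apply Rmult_0_r.
Qed.

(** The comparison with a constant serves twice: for the remainder of an affine
    approximation in the bisection argument, and for the mean of a function over
    a period. *)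
Lemma CInt_near_const (f : R -> C) (k : C) (a b M : R) :
  (a <= b)%R -> ex_CInt f a b ->
  (forall t, (a <= t <= b)%R -> (Cmod (f t - k) <= M)%R) ->
  (Cmod (CInt f a b - (RtoC b - RtoC a) * k) <= (b - a) * M)%R.
Proof.
  intros Hab [H1 H2] HM.
  assert (Hi : is_RInt (V := C_R_NormedModule) f a b (CInt f a b)).
  { apply is_RInt_fct_extend_pair; apply (RInt_correct (V := R_CompleteNormedModule)); assumption. }
  assert (Hk := is_RInt_const (V := C_R_NormedModule) a b k).
  assert (Hm := is_RInt_minus (V := C_R_NormedModule) _ _ _ _ _ _ Hi Hk).
  apply (norm_RInt_le_const _ _ _ _ M) in Hm; [|exact Hab|].
  - rewrite <- Cmod_norm in Hm.
    replace (CInt f a b - (RtoC b - RtoC a) * k) with (minus (CInt f a b) (scal (b - a)%R k : C_R_NormedModule)).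
    exact Hm. apply injective_projections; simpl;
     unfold scal, minus, plus, opp, mult; simpl; unfold mult; simpl; ring.
  - intros t Ht. rewrite <- Cmod_norm. apply (HM t Ht).
Qed.

Lemma ex_CInt_continuous (f : R -> C) (a b : R) :
  (forall t, (Rmin a b <= t <= Rmax a b)%R ->
     forall eps, (0 < eps)%R -> exists d, (0 < d)%R /\
       forall s, (Rabs (s - t) < d)%R -> (Cmod (f s - f t) < eps)%R) ->
  ex_CInt f a b.
Proof.
  intros H.
  assert (E : forall p : C -> R, (forall z w : C, p (z - w)%C = p z - p w)%R ->
     (forall z, Rabs (p z) <= Cmod z)%R -> ex_RInt (fun n => p (f n)) a b).
  { intros p Hp Hpm. apply (ex_RInt_continuous (V := R_CompleteNormedModule)).
    intros t Ht P [eps HP]. destruct (H t Ht eps (cond_pos eps)) as [d [Hd Hs]].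
    exists (mkposreal d Hd). intros s Hs'. apply HP.
    change (Rabs (p (f s) - p (f t)) < eps)%R. rewrite <- Hp.
    eapply Rle_lt_trans; [apply Hpm|]. apply Hs. exact Hs'. }
  split; apply E; try reflexivity. apply re_le_Cmod. apply Cmod_Im_le.
Qed.

Lemma nested_limit (u v : nat -> R) (s : R) :
  (forall n, u n <= u (S n))%R -> (forall n, v (S n) <= v n)%R ->
  (forall n, v n - u n = s * (1 / 2) ^ n)%R ->
  exists x, forall n, (u n <= x <= v n)%R.
Proof.
  intros Hu Hv Huv.
  assert (L : is_lim_seq (fun n => v n - u n)%R 0).
  { apply is_lim_seq_ext with (fun n => s * (1 / 2) ^ n)%R; [intros; symmetry; apply Huv|].
    replace (Finite 0) with (Rbar_mult s 0) by (simpl; f_equal; ring).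
    apply is_lim_seq_scal_l, is_lim_seq_geom. rewrite Rabs_right; lra. }
  destruct (ex_lim_seq_adj u v Hu Hv L) as [[lu Lu] [[lv Lv] E]].
  rewrite (is_lim_seq_unique _ _ Lu), (is_lim_seq_unique _ _ Lv) in E.
  injection E as ->. exists lv. intros n. split.
  - apply (is_lim_seq_incr_compare u); assumption.
  - apply (is_lim_seq_decr_compare v); assumption.
Qed.

(** The combinatorial half of Goursat's lemma.  An additive function of
    rectangles that is [o(diameter^2)] at every point must vanish: bisect
    repeatedly in both directions, keeping each time the half on which the modulus
    is at least half of the previous one.  After [n] rounds the value has lost at
    most a factor [4^n], while the squared diameter has lost exactly that factor,
    which contradicts the local hypothesis at the common point. *)
Section Bisection.
Variable J : R -> R -> R -> R -> C.
Variables A B P Q : R.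
Hypothesis HAB : (A <= B)%R.
Hypothesis HPQ : (P <= Q)%R.

Let inside (a b c d : R) : Prop := (A <= a /\ a <= b /\ b <= B /\ P <= c /\ c <= d /\ d <= Q)%R.

Hypothesis Jx : forall a m b c d, inside a b c d -> (a <= m <= b)%R ->
  J a b c d = J a m c d + J m b c d.
Hypothesis Jy : forall a b c m d, inside a b c d -> (c <= m <= d)%R ->
  J a b c d = J a b c m + J a b m d.
Hypothesis Jloc : forall x y, (A <= x <= B)%R -> (P <= y <= Q)%R ->
  forall eps, (0 < eps)%R -> exists r, (0 < r)%R /\
    forall a b c d, inside a b c d -> (a <= x <= b)%R -> (c <= y <= d)%R ->
      (b - a < r)%R -> (d - c < r)%R ->
      (Cmod (J a b c d) <= eps * (b - a + (d - c)) ^ 2)%R.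

Let halve_x (q : R * R * R * R) : R * R * R * R :=
  let '(a, b, c, d) := q in
  let m := ((a + b) / 2)%R in
  if Rle_dec (Cmod (J a b c d)) (2 * Cmod (J a m c d)) then (a, m, c, d) else (m, b, c, d).

Let halve_y (q : R * R * R * R) : R * R * R * R :=
  let '(a, b, c, d) := q in
  let m := ((c + d) / 2)%R in
  if Rle_dec (Cmod (J a b c d)) (2 * Cmod (J a b c m)) then (a, b, c, m) else (a, b, m, d).

Let quarter_spec (a b c d : R) :
  inside a b c d ->
  let '(a', b', c', d') := halve_y (halve_x (a, b, c, d)) in
  inside a' b' c' d' /\
  (a <= a' /\ b' <= b /\ c <= c' /\ d' <= d /\
   b' - a' = (b - a) / 2 /\ d' - c' = (d - c) / 2 /\
   Cmod (J a b c d) <= 4 * Cmod (J a' b' c' d'))%R.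
Proof.
  assert (Hsplit : forall p q r : C, p = q + r -> ~ (Cmod p <= 2 * Cmod q)%R ->
    (Cmod p <= 2 * Cmod r)%R).
  { intros p q r -> Hn. assert (H := Cmod_triangle q r). lra. }
  intros Hin.
  assert (Hx : let '(a', b', c', d') := halve_x (a, b, c, d) in
    inside a' b' c' d' /\ c' = c /\ d' = d /\
    (a <= a' /\ b' <= b /\ b' - a' = (b - a) / 2 /\
    Cmod (J a b c d) <= 2 * Cmod (J a' b' c' d'))%R).
  { unfold halve_x. destruct (Rle_dec _ _) as [H|H].
    - unfold inside in *. repeat split; try lra.
    - apply (Hsplit _ _ (J ((a + b) / 2)%R b c d)) in H.
      unfold inside in *. repeat split; try lra.
      apply Jx; unfold inside in *; lra. }
  destruct (halve_x (a, b, c, d)) as [[[a1 b1] c1] d1].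
  destruct Hx as [Hin1 [-> [-> Hx]]].
  unfold halve_y. destruct (Rle_dec _ _) as [H|H].
    - unfold inside in *. repeat split; try lra.
    - apply (Hsplit _ _ (J a1 b1 ((c + d) / 2)%R d)) in H.
      unfold inside in *. repeat split; try lra.
      apply Jy; unfold inside in *; lra.
Qed.

Let seqq (n : nat) : R * R * R * R := Nat.iter n (fun q => halve_y (halve_x q)) (A, B, P, Q).
Let sa n : R := fst (fst (fst (seqq n))).
Let sb n : R := snd (fst (fst (seqq n))).
Let sc n : R := snd (fst (seqq n)).
Let sd n : R := snd (seqq n).

Let seqq_step n : inside (sa n) (sb n) (sc n) (sd n) ->
  inside (sa (S n)) (sb (S n)) (sc (S n)) (sd (S n)) /\
  (sa n <= sa (S n) /\ sb (S n) <= sb n /\ sc n <= sc (S n) /\ sd (S n) <= sd n /\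
   sb (S n) - sa (S n) = (sb n - sa n) / 2 /\ sd (S n) - sc (S n) = (sd n - sc n) / 2 /\
   Cmod (J (sa n) (sb n) (sc n) (sd n)) <= 4 * Cmod (J (sa (S n)) (sb (S n)) (sc (S n)) (sd (S n))))%R.
Proof.
  intros H. apply quarter_spec in H. revert H. unfold sa, sb, sc, sd.
  change (seqq (S n)) with (halve_y (halve_x (seqq n))).
  destruct (seqq n) as [[[a b] c] d]. cbn [fst snd].
  destruct (halve_y (halve_x (a, b, c, d))) as [[[a' b'] c'] d']. cbn [fst snd]. tauto.
Qed.

Let seqq_spec n : inside (sa n) (sb n) (sc n) (sd n) /\
  (sb n - sa n = (B - A) * (1 / 2) ^ n /\ sd n - sc n = (Q - P) * (1 / 2) ^ n /\
   Cmod (J A B P Q) * ((1 / 2) ^ n) ^ 2 <= Cmod (J (sa n) (sb n) (sc n) (sd n)))%R.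
Proof.
  induction n as [|n IH].
  - unfold sa, sb, sc, sd, inside; simpl. repeat split; lra.
  - destruct IH as [Hin [H1 [H2 H3]]]. destruct (seqq_step n Hin) as [Hin' H].
    destruct H as (_&_&_&_&H4&H5&H6). split; [exact Hin'|].
    rewrite H4, H5, H1, H2. cbn [pow]. repeat split; try field.
    cbn [pow] in H3. lra.
Qed.

Lemma additive_rectangle_function_zero : J A B P Q = 0.
Proof.
  assert (Hstep := fun n => proj2 (seqq_step n (proj1 (seqq_spec n)))).
  destruct (nested_limit sa sb (B - A)) as [x Hx];
    try (intros n; destruct (Hstep n) as (?&?&?&?&?); assumption).
  { intros n. apply (seqq_spec n). }
  destruct (nested_limit sc sd (Q - P)) as [y Hy];
    try (intros n; destruct (Hstep n) as (?&?&?&?&?); assumption).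
  { intros n. apply (seqq_spec n). }
  apply Cmod_eq_0, Rle_antisym; [|apply Cmod_ge_0].
  apply le_epsilon. intros eps He. rewrite Rplus_0_l.
  set (S := (B - A + (Q - P) + 1)%R).
  assert (HS : (0 < S)%R) by (unfold S; lra).
  assert (HS2 : (0 < S ^ 2)%R) by (apply pow_lt; exact HS).
  destruct (Jloc x y (Hx 0%nat) (Hy 0%nat) (eps / S ^ 2)%R) as [r [Hr HJ]].
  { apply Rdiv_lt_0_compat; assumption. }
  destruct (pow_lt_1_zero (1 / 2) ltac:(rewrite Rabs_right; lra) (r / S)%R) as [n Hn].
  { apply Rdiv_lt_0_compat; assumption. }
  specialize (Hn n (le_n n)).
  destruct (seqq_spec n) as [Hin [H1 [H2 H3]]].
  set (t := ((1 / 2) ^ n)%R) in *.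
  assert (Ht : (0 < t)%R) by (apply pow_lt; lra).
  rewrite Rabs_right in Hn by lra.
  apply (Rmult_lt_compat_r S) in Hn; [|exact HS].
  replace (r / S * S)%R with r in Hn by (field; lra).
  assert (Hsmall : (sb n - sa n < r /\ sd n - sc n < r)%R).
  { rewrite H1, H2. unfold S in Hn. split; nra. }
  specialize (HJ _ _ _ _ Hin (Hx n) (Hy n) (proj1 Hsmall) (proj2 Hsmall)).
  rewrite H1, H2 in HJ.
  assert (Hb : (Cmod (J A B P Q) * t ^ 2 <= eps * t ^ 2)%R).
  { eapply Rle_trans; [exact H3|]. eapply Rle_trans; [exact HJ|].
    apply Rle_trans with (eps / S ^ 2 * (S * t) ^ 2)%R.
    - apply Rmult_le_compat_l; [left; apply Rdiv_lt_0_compat; assumption|].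
      apply pow_incr. unfold S. nra.
    - right. field. lra. }
  apply Rmult_le_reg_r in Hb; [exact Hb|]. apply pow_lt; exact Ht.
Qed.
End Bisection.

(** * Goursat's lemma and the maximum principle *)

Lemma Cmod_horizontal (s t y : R) : Cmod ((s, y) - (t, y)) = Rabs (s - t).
Proof. rewrite <- Cmod_R. f_equal. apply injective_projections; simpl; ring. Qed.

Lemma Cmod_vertical (x s t : R) : Cmod ((x, s) - (x, t)) = Rabs (s - t).
Proof.
  rewrite <- Cmod_R, <- (Rmult_1_l (Cmod (RtoC _))), <- Cmod_Ci, <- Cmod_mult.
  f_equal. apply injective_projections; simpl; ring.
Qed.

(** The integral of [F] along the boundary of the rectangle, with opposite sides
    grouped together: for affine [F] both integrands are then constant and the two
    terms visibly cancel. *)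
Definition boundary_integral (F : C -> C) (a b c d : R) : C :=
  CInt (fun t => F (t, c) - F (t, d)) a b + Ci * CInt (fun t => F (b, t) - F (a, t)) c d.

Section Goursat.
Variable F : C -> C.
Variables A B P Q : R.
Hypothesis HAB : (A <= B)%R.
Hypothesis HPQ : (P <= Q)%R.
Hypothesis HF : forall x y, (A <= x <= B)%R -> (P <= y <= Q)%R -> exists l, is_cderive F (x, y) l.

Let ex_horizontal a b c d : (A <= a)%R -> (a <= b)%R -> (b <= B)%R -> (P <= c <= Q)%R -> (P <= d <= Q)%R ->
  ex_CInt (fun t => F (t, c) - F (t, d)) a b.
Proof.
  intros Ha Hab Hb Hc Hd. apply ex_CInt_continuous.
  rewrite Rmin_left, Rmax_right by exact Hab. intros t Ht eps He.
  destruct (HF t c) as [l Hl]; [lra|exact Hc|].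
  destruct (HF t d) as [k Hk]; [lra|exact Hd|].
  destruct (is_cderive_cont _ _ _ Hl (eps / 2)%R ltac:(lra)) as [d1 [Hd1 H1]].
  destruct (is_cderive_cont _ _ _ Hk (eps / 2)%R ltac:(lra)) as [d2 [Hd2 H2]].
  exists (Rmin d1 d2). split; [apply Rmin_pos; assumption|]. intros s Hs.
  specialize (H1 (s, c)). specialize (H2 (s, d)). rewrite Cmod_horizontal in H1, H2.
  specialize (H1 (Rlt_le_trans _ _ _ Hs (Rmin_l _ _))).
  specialize (H2 (Rlt_le_trans _ _ _ Hs (Rmin_r _ _))).
  rewrite Cmod_minus_sym in H2.
  replace (F (s, c) - F (s, d) - (F (t, c) - F (t, d)))
    with ((F (s, c) - F (t, c)) + (F (t, d) - F (s, d))) by ring.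
  eapply Rle_lt_trans; [apply Cmod_triangle|]. lra.
Qed.

Let ex_vertical a b c d : (A <= a <= B)%R -> (A <= b <= B)%R -> (P <= c)%R -> (c <= d)%R -> (d <= Q)%R ->
  ex_CInt (fun t => F (b, t) - F (a, t)) c d.
Proof.
  intros Ha Hb Hc Hcd Hd. apply ex_CInt_continuous.
  rewrite Rmin_left, Rmax_right by exact Hcd. intros t Ht eps He.
  destruct (HF b t) as [l Hl]; [exact Hb|lra|].
  destruct (HF a t) as [k Hk]; [exact Ha|lra|].
  destruct (is_cderive_cont _ _ _ Hl (eps / 2)%R ltac:(lra)) as [d1 [Hd1 H1]].
  destruct (is_cderive_cont _ _ _ Hk (eps / 2)%R ltac:(lra)) as [d2 [Hd2 H2]].
  exists (Rmin d1 d2). split; [apply Rmin_pos; assumption|]. intros s Hs.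
  specialize (H1 (b, s)). specialize (H2 (a, s)). rewrite Cmod_vertical in H1, H2.
  specialize (H1 (Rlt_le_trans _ _ _ Hs (Rmin_l _ _))).
  specialize (H2 (Rlt_le_trans _ _ _ Hs (Rmin_r _ _))).
  rewrite Cmod_minus_sym in H2.
  replace (F (b, s) - F (a, s) - (F (b, t) - F (a, t)))
    with ((F (b, s) - F (b, t)) + (F (a, t) - F (a, s))) by ring.
  eapply Rle_lt_trans; [apply Cmod_triangle|]. lra.
Qed.

Let boundary_small x y : (A <= x <= B)%R -> (P <= y <= Q)%R ->
  forall eps, (0 < eps)%R -> exists r, (0 < r)%R /\
    forall a b c d, (A <= a /\ a <= b /\ b <= B /\ P <= c /\ c <= d /\ d <= Q)%R ->
      (a <= x <= b)%R -> (c <= y <= d)%R -> (b - a < r)%R -> (d - c < r)%R ->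
      (Cmod (boundary_integral F a b c d) <= eps * (b - a + (d - c)) ^ 2)%R.
Proof.
  intros Hx Hy eps He. destruct (HF x y Hx Hy) as [l Hl].
  destruct (proj1 (is_cderive_Cmod _ _ _) Hl (eps / 2)%R ltac:(lra)) as [r [Hr H]].
  exists (r / 2)%R. split; [lra|]. intros a b c d Hin Hxab Hycd Hba Hdc.
  set (s := (b - a + (d - c))%R).
  assert (HG : forall u v, (a <= u <= b)%R -> (c <= v <= d)%R ->
    (Cmod (F (u, v) - F (x, y) - l * ((u, v) - (x, y))) <= eps / 2 * s)%R).
  { intros u v Hu Hv.
    assert (Hs : (Cmod ((u, v) - (x, y)) <= s)%R).
    { eapply Rle_trans; [apply Cmod_le_ReIm|]. simpl. unfold s.
      apply Rplus_le_compat; apply Rabs_le; lra. }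
    eapply Rle_trans; [apply H; unfold s in Hs; lra|].
    apply Rmult_le_compat_l; lra. }
  assert (Hdiff : forall u v u' v', (a <= u <= b)%R -> (c <= v <= d)%R -> (a <= u' <= b)%R -> (c <= v' <= d)%R ->
    (Cmod (F (u, v) - F (u', v') - l * ((u, v) - (u', v'))) <= eps * s)%R).
  { intros u v u' v' Hu Hv Hu' Hv'.
    replace (F (u, v) - F (u', v') - l * ((u, v) - (u', v'))) with
     ((F (u, v) - F (x, y) - l * ((u, v) - (x, y))) - (F (u', v') - F (x, y) - l * ((u', v') - (x, y)))) by ring.
    eapply Rle_trans; [apply Cmod_triangle_minus|].
    assert (H1 := HG u v Hu Hv). assert (H2 := HG u' v' Hu' Hv'). lra. }
  unfold boundary_integral.
  (* The linear part contributes a constant to each of the two integrals. *)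
  assert (H1 := CInt_near_const (fun t => F (t, c) - F (t, d)) (l * (Ci * (RtoC c - RtoC d))) a b (eps * s)).
  assert (H2 := CInt_near_const (fun t => F (b, t) - F (a, t)) (l * (RtoC b - RtoC a)) c d (eps * s)).
  specialize (H1 ltac:(lra) ltac:(apply ex_horizontal; lra)).
  specialize (H2 ltac:(lra) ltac:(apply ex_vertical; lra)).
  apply Rle_trans with ((b - a) * (eps * s) + (d - c) * (eps * s))%R; [|unfold s; right; ring].
  match goal with |- (Cmod (?I + Ci * ?K) <= _)%R =>
    replace (I + Ci * K) with ((I - (RtoC b - RtoC a) * (l * (Ci * (RtoC c - RtoC d)))) +
       Ci * (K - (RtoC d - RtoC c) * (l * (RtoC b - RtoC a)))) by ring end.
  eapply Rle_trans; [apply Cmod_triangle|]. rewrite Cmod_mult, Cmod_Ci, Rmult_1_l.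
  apply Rplus_le_compat.
  - apply H1. intros t Ht.
    replace (Ci * (RtoC c - RtoC d)) with ((t, c) - (t, d)) by (apply injective_projections; simpl; ring).
    apply Hdiff; lra.
  - apply H2. intros t Ht.
    replace (RtoC b - RtoC a) with ((b, t) - (a, t)) by (apply injective_projections; simpl; ring).
    apply Hdiff; lra.
Qed.

Lemma Goursat_rectangle : boundary_integral F A B P Q = 0.
Proof.
  apply (additive_rectangle_function_zero (boundary_integral F));
    [exact HAB | exact HPQ | | | exact boundary_small].
  - intros a m b c d Hin Hm. unfold boundary_integral.
    rewrite (CInt_Chasles _ a m b) by (apply ex_horizontal; lra).
    rewrite (CInt_plus_ext (fun t => F (b, t) - F (m, t)) (fun t => F (m, t) - F (a, t)) (fun t => F (b, t) - F (a, t))).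
    + ring.
    + apply ex_vertical; lra.
    + apply ex_vertical; lra.
    + intros; ring.
  - intros a b c m d Hin Hm. unfold boundary_integral.
    rewrite (CInt_Chasles _ c m d) by (apply ex_vertical; lra).
    rewrite (CInt_plus_ext (fun t => F (t, c) - F (t, m)) (fun t => F (t, m) - F (t, d)) (fun t => F (t, c) - F (t, d))).
    + ring.
    + apply ex_horizontal; lra.
    + apply ex_horizontal; lra.
    + intros; ring.
Qed.

Let CInt_vertical_exists : ex_CInt (fun t => F (B, t) - F (A, t)) P Q.
Proof. apply ex_vertical; lra. Qed.

(** Horizontal sides cancel by periodicity, so the integral over a vertical
    period is the same at both abscissas. *)
Lemma Goursat_periodic : (forall t, F (t, P) = F (t, Q)) ->
  ex_CInt (fun t => F (B, t) - F (A, t)) P Q /\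
  CInt (fun t => F (B, t) - F (A, t)) P Q = 0.
Proof.
  intros Hper. split; [exact CInt_vertical_exists|].
  assert (H := Goursat_rectangle). unfold boundary_integral in H.
  rewrite CInt_0_ext in H by (intros t; rewrite Hper; ring).
  set (I := CInt _ P Q) in *.
  assert (E : I = - Ci * (0 + Ci * I)).
  { destruct I as [u v]. apply injective_projections; simpl; ring. }
  rewrite E, H. ring.
Qed.
End Goursat.

Definition cexp (w : C) : C := RtoC (exp (Re w)) * (cos (Im w), sin (Im w)).

Lemma cexp_plus (z w : C) : cexp (z + w) = cexp z * cexp w.
Proof.
  destruct z as [x y], w as [u v]. unfold cexp. simpl.
  rewrite exp_plus, cos_plus, sin_plus. apply injective_projections; simpl; ring.
Qed.

Lemma Cmod_cexp (w : C) : Cmod (cexp w) = exp (Re w).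
Proof.
  unfold cexp. rewrite Cmod_mult, Cmod_R, Rabs_right by (left; apply exp_pos).
  unfold Cmod. simpl. replace (_ + _)%R with 1%R.
  - rewrite sqrt_1. ring.
  - assert (H := sin2_cos2 (Im w)). unfold Rsqr in H. lra.
Qed.

Lemma derivable_pt_lim_small (f : R -> R) (l : R) :
  derivable_pt_lim f 0 l -> forall eps, (0 < eps)%R -> exists d, (0 < d)%R /\
    forall h, (Rabs h < d)%R -> (Rabs (f h - f 0 - l * h) <= eps * Rabs h)%R.
Proof.
  intros H eps He. destruct (H eps He) as [d Hd]. exists d. split; [apply cond_pos|].
  intros h Hh. destruct (Req_dec h 0) as [->|Hn].
  - replace (f 0 - f 0 - l * 0)%R with 0%R by ring. rewrite Rabs_R0. lra.
  - specialize (Hd h Hn Hh). rewrite Rplus_0_l in Hd.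
    replace (f h - f 0 - l * h)%R with (((f h - f 0) / h - l) * h)%R by (field; exact Hn).
    rewrite Rabs_mult. apply Rmult_le_compat_r; [apply Rabs_pos|lra].
Qed.

(** Differentiability of the exponential at 0; the addition formula then moves
    it to every point. *)
Lemma cexp_small (eps : R) : (0 < eps)%R -> exists d, (0 < d)%R /\
  forall h, (Cmod h < d)%R -> (Cmod (cexp h - 1 - h) <= eps * Cmod h)%R.
Proof.
  intros He. set (e := Rmin (eps / 6) (1 / 2)).
  assert (He1 : (0 < e)%R) by (apply Rmin_pos; lra).
  assert (He2 : (6 * e <= eps)%R) by (assert (H := Rmin_l (eps / 6) (1 / 2)); unfold e; lra).
  assert (He3 : (e <= 1 / 2)%R) by apply Rmin_r.
  destruct (derivable_pt_lim_small exp 1 derivable_pt_lim_exp_0 e He1) as [d1 [Hd1 H1]].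
  destruct (derivable_pt_lim_small sin 1 derivable_pt_lim_sin_0 e He1) as [d2 [Hd2 H2]].
  destruct (derivable_pt_lim_small cos (- sin 0) (derivable_pt_lim_cos 0) e He1) as [d3 [Hd3 H3]].
  exists (Rmin (Rmin d1 d2) (Rmin d3 (e / 2))).
  split; [repeat apply Rmin_pos; lra|]. intros h Hh.
  assert (K1 := Rlt_le_trans _ _ _ Hh (Rmin_l _ _)).
  assert (K2 := Rlt_le_trans _ _ _ Hh (Rmin_r _ _)).
  assert (K3 := Rlt_le_trans _ _ _ K1 (Rmin_l _ _)).
  assert (K4 := Rlt_le_trans _ _ _ K1 (Rmin_r _ _)).
  assert (K5 := Rlt_le_trans _ _ _ K2 (Rmin_l _ _)).
  assert (K6 := Rlt_le_trans _ _ _ K2 (Rmin_r _ _)). clear K1 K2 Hh.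
  assert (Hx := re_le_Cmod h). assert (Hy := Cmod_Im_le h).
  destruct h as [x y]. unfold cexp. simpl Re in *. simpl Im in *.
  specialize (H1 x ltac:(lra)). specialize (H2 y ltac:(lra)). specialize (H3 y ltac:(lra)).
  rewrite exp_0, Rmult_1_l in H1. rewrite sin_0, Rmult_1_l, Rminus_0_r in H2.
  rewrite cos_0, sin_0, Ropp_0, Rmult_0_l, Rminus_0_r in H3.
  set (n := Cmod (x, y)) in *.
  assert (H5 : (Rabs (exp x - 1) <= e)%R).
  { replace (exp x - 1)%R with ((exp x - 1 - x) + x)%R by ring.
    eapply Rle_trans; [apply Rabs_triang|].
    assert (Hp := Rabs_pos x). nra. }
  assert (H6 : (0 <= exp x <= 2)%R).
  { split; [left; apply exp_pos|]. assert (H := Rle_abs (exp x - 1)). lra. }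
  replace (RtoC (exp x) * (cos y, sin y) - 1 - (x, y)) with
    (RtoC (exp x) * (RtoC (cos y - 1) + Ci * RtoC (sin y - y)) +
     (RtoC (exp x - 1 - x) + Ci * (RtoC y * RtoC (exp x - 1))))
    by (apply injective_projections; simpl; ring).
  eapply Rle_trans; [apply Cmod_triangle|].
  rewrite Cmod_mult, Cmod_R, (Rabs_right (exp x)) by lra.
  assert (T1 := Cmod_triangle (RtoC (cos y - 1)) (Ci * RtoC (sin y - y))).
  assert (T2 := Cmod_triangle (RtoC (exp x - 1 - x)) (Ci * (RtoC y * RtoC (exp x - 1)))).
  rewrite Cmod_mult, !Cmod_R, Cmod_Ci, Rmult_1_l in T1.
  rewrite !Cmod_mult, !Cmod_R, Cmod_Ci, Rmult_1_l in T2.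
  assert (T3 : (Rabs y * Rabs (exp x - 1) <= n * e)%R).
  { apply Rmult_le_compat; try apply Rabs_pos; lra. }
  assert (Hn : (0 <= n)%R) by apply Cmod_ge_0.
  assert (T4 : (e * Rabs y <= e * n)%R) by (apply Rmult_le_compat_l; lra).
  assert (T5 : (e * Rabs x <= e * n)%R) by (apply Rmult_le_compat_l; lra).
  assert (T6 := Cmod_ge_0 (RtoC (cos y - 1) + Ci * RtoC (sin y - y))).
  apply Rle_trans with (2 * (2 * (e * n)) + 2 * (e * n))%R; [|nra].
  apply Rplus_le_compat; [|lra].
  apply Rmult_le_compat; lra.
Qed.

Lemma is_cderive_cexp (w : C) : is_cderive cexp w (cexp w).
Proof.
  apply is_cderive_Cmod. intros eps He.
  assert (Hpos : (0 < Cmod (cexp w))%R) by (rewrite Cmod_cexp; apply exp_pos).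
  destruct (cexp_small (eps / Cmod (cexp w))) as [d [Hd H]].
  { apply Rdiv_lt_0_compat; assumption. }
  exists d. split; [exact Hd|]. intros z Hz. specialize (H _ Hz).
  replace (cexp z) with (cexp w * cexp (z - w)).
  2:{ rewrite <- cexp_plus. f_equal. ring. }
  replace (_ - _ - _) with (cexp w * (cexp (z - w) - 1 - (z - w))) by ring.
  rewrite Cmod_mult. apply (Rmult_le_compat_l (Cmod (cexp w))) in H; [|lra].
  replace (eps * Cmod (z - w))%R with (Cmod (cexp w) * (eps / Cmod (cexp w) * Cmod (z - w)))%R; [exact H|].
  field. lra.
Qed.

(** With [F w = g (cexp w)], the periods at abscissas [ln rho] and [A] carry the
    same integral by Goursat.  On the first [g] is bounded by [m], on the second
    it is within [eps] of [g 0] when [A] is negative enough.  The rectangles avoid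
    the preimage of the origin, and this is why continuity suffices there; that is
    the case needed for difference quotients. *)
Lemma max_principle (g : C -> C) (r rho m : R) :
  (0 < rho < r)%R ->
  (forall z : C, z <> 0 -> (Cmod z < r)%R -> exists l, is_cderive g z l) ->
  (forall eps, (0 < eps)%R -> exists d, (0 < d)%R /\
     forall w, (Cmod w < d)%R -> (Cmod (g w - g 0) < eps)%R) ->
  (forall z, Cmod z = rho -> (Cmod (g z) <= m)%R) ->
  (Cmod (g 0) <= m)%R.
Proof.
  intros Hr Hg Hc Hm. apply le_epsilon. intros eps He.
  destruct (Hc eps He) as [d [Hd Hw]].
  set (B := ln rho). set (A := Rmin B (ln (d / 2))).
  assert (HAB : (A <= B)%R) by apply Rmin_l.
  assert (HA : (exp A < d)%R).
  { apply Rle_lt_trans with (d / 2)%R; [|lra]. rewrite <- (exp_ln (d / 2)) by lra.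
    destruct (Rmin_r B (ln (d / 2))) as [H|H].
    - left. apply exp_increasing. exact H.
    - right. unfold A. rewrite H. reflexivity. }
  assert (HB : exp B = rho) by (apply exp_ln; lra).
  assert (HPI := PI_RGT_0).
  destruct (Goursat_periodic (fun w => g (cexp w)) A B 0 (2 * PI)) as [E I].
  - exact HAB.
  - lra.
  - intros x y Hx Hy.
    assert (Hmod : Cmod (cexp (x, y)) = exp x) by apply Cmod_cexp.
    destruct (Hg (cexp (x, y))) as [l Hl].
    + apply Cmod_gt_0. rewrite Hmod. apply exp_pos.
    + rewrite Hmod. apply Rle_lt_trans with rho; [|lra]. rewrite <- HB.
      destruct (proj2 Hx) as [H| ->]; [left; apply exp_increasing, H|right; reflexivity].
    + eexists. apply is_cderive_comp. exact Hl. apply is_cderive_cexp.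
  - intros t. unfold cexp. simpl. rewrite cos_2PI, sin_2PI, cos_0, sin_0. reflexivity.
  - assert (H := CInt_near_const _ (- g 0) 0 (2 * PI) (m + eps) ltac:(lra) E).
    rewrite I in H.
    replace (0 - (RtoC (2 * PI) - 0) * - g 0) with (RtoC (2 * PI) * g 0) in H by ring.
    rewrite Cmod_mult, Cmod_R, Rabs_right in H by lra.
    apply (Rmult_le_reg_l (2 * PI)); [lra|]. rewrite Rminus_0_r in H. apply H.
    intros t _.
    replace (g (cexp (B, t)) - g (cexp (A, t)) - - g 0) with
      (g (cexp (B, t)) - (g (cexp (A, t)) - g 0)) by ring.
    eapply Rle_trans; [apply Cmod_triangle_minus|].
    apply Rplus_le_compat.
    + apply Hm. rewrite Cmod_cexp. exact HB.
    + left. apply Hw. rewrite Cmod_cexp. exact HA.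
Qed.

(** * Cauchy estimates and limits of holomorphic functions *)

Lemma is_cderive_ext_loc (f g : C -> C) (z l : C) (d : R) :
  (0 < d)%R -> (forall w, (Cmod (w - z) < d)%R -> f w = g w) ->
  is_cderive f z l -> is_cderive g z l.
Proof.
  intros Hd Hfg Hf. apply is_cderive_Cmod. intros eps He.
  destruct (proj1 (is_cderive_Cmod _ _ _) Hf eps He) as [d' [Hd' H]].
  exists (Rmin d d'). split; [apply Rmin_pos; assumption|]. intros w Hw.
  rewrite <- (Hfg w), <- (Hfg z).
  - apply H. eapply Rlt_le_trans; [exact Hw|apply Rmin_r].
  - replace (z - z) with (RtoC 0) by ring. rewrite Cmod_0. exact Hd.
  - eapply Rlt_le_trans; [exact Hw|apply Rmin_l].
Qed.

Lemma is_cderive_shift (f : C -> C) (a z l : C) :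
  is_cderive f (a + z) l -> is_cderive (fun w => f (a + w)) z l.
Proof.
  intros H. replace l with ((0 + 1) * l) by ring.
  apply (is_cderive_comp f (fun w => a + w)); [exact H|].
  apply is_cderive_plus; [apply is_cderive_const|apply is_cderive_id].
Qed.

(** The maximum principle for the difference quotient of [h] at [a], extended by
    the derivative at the centre. *)
Lemma Cauchy_estimate (h : C -> C) (a l : C) (r rho m : R) :
  (0 < rho < r)%R ->
  (forall z, (Cmod (z - a) < r)%R -> exists k, is_cderive h z k) ->
  is_cderive h a l ->
  (forall z, Cmod (z - a) = rho -> (Cmod (h z - h a) <= m)%R) ->
  (Cmod l <= m / rho)%R.
Proof.
  intros Hr Hh Hl Hm.
  set (q := fun z : C => (h (a + z) - h a) * / z).
  set (g := fun z : C => if Req_EM_T (Cmod z) 0 then l else q z).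
  assert (Hg : forall z : C, z <> 0 -> g z = q z).
  { intros z Hz. unfold g. destruct (Req_EM_T (Cmod z) 0) as [E|E]; [|reflexivity].
    exfalso. apply Hz, Cmod_eq_0, E. }
  assert (Hg0 : g 0 = l).
  { unfold g. destruct (Req_EM_T (Cmod 0) 0) as [E|E]; [reflexivity|].
    exfalso. apply E, Cmod_0. }
  rewrite <- Hg0. apply (max_principle g r rho); [exact Hr| | |].
  - intros z Hz Hzr. destruct (Hh (a + z)) as [k Hk].
    { replace (a + z - a) with z by ring. exact Hzr. }
    eexists. apply (is_cderive_ext_loc q _ _ _ (Cmod z)).
    + apply Cmod_gt_0, Hz.
    + intros w Hw. symmetry. apply Hg. intros ->.
      rewrite Cmod_minus_sym in Hw. replace (z - 0) with z in Hw by ring. lra.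
    + apply is_cderive_mult.
      * apply is_cderive_minus; [apply is_cderive_shift; exact Hk|apply is_cderive_const].
      * apply is_cderive_inv, Hz.
  - intros eps He. destruct (proj1 (is_cderive_Cmod _ _ _) Hl (eps / 2)%R ltac:(lra)) as [d [Hd H]].
    exists d. split; [exact Hd|]. intros w Hw. rewrite Hg0.
    destruct (Req_EM_T (Cmod w) 0) as [E|E].
    + apply Cmod_eq_0 in E. subst w. rewrite Hg0.
      replace (l - l) with (RtoC 0) by ring. rewrite Cmod_0. exact He.
    + assert (Hw0 : w <> 0) by (intros ->; apply E, Cmod_0).
      assert (Hwp := proj1 (Cmod_gt_0 w) Hw0).
      rewrite Hg by exact Hw0. specialize (H (a + w)).
      replace (a + w - a) with w in H by ring. specialize (H Hw).
      unfold q. replace ((h (a + w) - h a) * / w - l) with ((h (a + w) - h a - l * w) * / w) by (field; exact Hw0).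
      rewrite Cmod_mult, Cmod_inv by exact Hw0.
      apply (Rmult_lt_reg_r (Cmod w)); [exact Hwp|].
      rewrite Rmult_assoc, Rinv_l, Rmult_1_r by lra. nra.
  - intros z Hz. assert (Hz0 : z <> 0) by (apply Cmod_gt_0; lra).
    rewrite Hg by exact Hz0. unfold q. rewrite Cmod_mult, Cmod_inv, Hz by exact Hz0.
    apply Rmult_le_compat_r; [left; apply Rinv_0_lt_compat; lra|].
    apply Hm. rewrite <- Hz. f_equal. ring.
Qed.

(** The real mean value theorem for the projection of [h] along the segment onto
    the direction of [h b - h a]. *)
Lemma mean_value_inequality (h : C -> C) (a b : C) (L : R) :
  (forall t : R, (0 <= t <= 1)%R ->
     exists l, is_cderive h (a + RtoC t * (b - a)) l /\ (Cmod l <= L)%R) ->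
  (Cmod (h b - h a) <= L * Cmod (b - a))%R.
Proof.
  intros H. set (c := Cconj (h b - h a)).
  set (p := fun t : R => Re (c * h (a + RtoC t * (b - a)))).
  assert (Hp : forall t l, is_cderive h (a + RtoC t * (b - a)) l ->
    is_derive p t (Re (c * (l * (b - a))))).
  { intros t l Hl. apply is_derive_Reals. intros eps He.
    set (K := (Cmod c * Cmod (b - a) + 1)%R).
    assert (HK : (0 < K)%R).
    { unfold K. assert (0 <= Cmod c * Cmod (b - a))%R by (apply Rmult_le_pos; apply Cmod_ge_0). lra. }
    destruct (proj1 (is_cderive_Cmod _ _ _) Hl (eps / K)%R) as [d [Hd Hw]].
    { apply Rdiv_lt_0_compat; assumption. }
    assert (Hba := Cmod_ge_0 (b - a)).
    assert (Hd' : (0 < d / (Cmod (b - a) + 1))%R) by (apply Rdiv_lt_0_compat; lra).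
    exists (mkposreal _ Hd'). intros s Hs0 Hs. simpl in Hs.
    specialize (Hw (a + RtoC (t + s) * (b - a))).
    replace (a + RtoC (t + s) * (b - a) - (a + RtoC t * (b - a))) with (RtoC s * (b - a)) in Hw.
    2:{ rewrite RtoC_plus. ring. }
    rewrite Cmod_mult, Cmod_R in Hw.
    assert (Hsd : (Rabs s * Cmod (b - a) < d)%R).
    { apply (Rmult_lt_compat_r (Cmod (b - a) + 1)) in Hs; [|lra].
      replace (d / (Cmod (b - a) + 1) * (Cmod (b - a) + 1))%R with d in Hs by (field; lra).
      assert (Hsp := Rabs_pos s). lra. }
    specialize (Hw Hsd).
    set (G := h (a + RtoC (t + s) * (b - a)) - h (a + RtoC t * (b - a)) - l * (RtoC s * (b - a))) in Hw.
    assert (HG : ((p (t + s) - p t) / s - Re (c * (l * (b - a))) = Re (c * G) / s)%R).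
    { replace (Re (c * G)) with (p (t + s) - p t - Re (c * (l * (b - a))) * s)%R.
      { field. exact Hs0. }
      unfold p, G. generalize (h (a + RtoC (t + s) * (b - a))) (h (a + RtoC t * (b - a))).
      intros u v. simpl. ring. }
    rewrite HG. unfold Rdiv. rewrite Rabs_mult, Rabs_inv.
    assert (Hsp := Rabs_pos_lt s Hs0).
    apply (Rmult_lt_reg_r (Rabs s)); [exact Hsp|].
    rewrite Rmult_assoc, Rinv_l, Rmult_1_r by lra.
    eapply Rle_lt_trans; [apply re_le_Cmod|]. rewrite Cmod_mult.
    apply Rle_lt_trans with (Cmod c * (eps / K * (Rabs s * Cmod (b - a))))%R.
    { apply Rmult_le_compat_l; [apply Cmod_ge_0|exact Hw]. }
    replace (Cmod c * (eps / K * (Rabs s * Cmod (b - a))))%R with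
      ((eps / K * Rabs s) * (K - 1))%R by (unfold K; ring).
    assert (0 < eps / K * Rabs s)%R.
    { apply Rmult_lt_0_compat; [apply Rdiv_lt_0_compat; assumption|exact Hsp]. }
    replace (eps * Rabs s)%R with ((eps / K * Rabs s) * K)%R by (field; lra).
    apply Rmult_lt_compat_l; lra. }
  assert (Hd : forall t, (0 <= t <= 1)%R -> is_derive p t (Derive p t)).
  { intros t Ht. destruct (H t Ht) as [l [Hl _]]. apply Derive_correct.
    eexists. apply Hp, Hl. }
  destruct (MVT_gen p 0 1 (Derive p)) as [t [Ht E]].
  { rewrite Rmin_left, Rmax_right by lra. intros t Ht. apply Hd. lra. }
  { rewrite Rmin_left, Rmax_right by lra. intros t Ht.
    apply continuity_pt_filterlim, (ex_derive_continuous (V := R_NormedModule)).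
    eexists. apply Hd, Ht. }
  rewrite Rmin_left, Rmax_right in Ht by lra.
  destruct (H t Ht) as [l [Hl HL]]. rewrite (is_derive_unique _ _ _ (Hp t l Hl)) in E.
  assert (E' : (Cmod (h b - h a) ^ 2 = Re (c * (l * (b - a))))%R).
  { rewrite Rminus_0_r, Rmult_1_r in E. rewrite <- E. unfold p.
    replace (a + RtoC 1 * (b - a)) with b by ring.
    replace (a + RtoC 0 * (b - a)) with a by ring.
    rewrite Cmod2_alt. unfold c. simpl. ring. }
  destruct (Req_dec (Cmod (h b - h a)) 0) as [Z|Z].
  { rewrite Z. apply Rmult_le_pos; [|apply Cmod_ge_0].
    eapply Rle_trans; [apply Cmod_ge_0|exact HL]. }
  assert (Hpos : (0 < Cmod (h b - h a))%R) by (assert (Hg := Cmod_ge_0 (h b - h a)); lra).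
  apply (Rmult_le_reg_l (Cmod (h b - h a))); [exact Hpos|].
  replace (Cmod (h b - h a) * Cmod (h b - h a))%R with (Cmod (h b - h a) ^ 2)%R by ring.
  rewrite E'. eapply Rle_trans; [apply Rle_abs|]. eapply Rle_trans; [apply re_le_Cmod|].
  rewrite !Cmod_mult. unfold c. rewrite Cmod_conj.
  apply Rmult_le_compat_l; [lra|].
  apply Rmult_le_compat_r; [apply Cmod_ge_0|exact HL].
Qed.

Lemma segment_ball (a b c : C) (r t : R) : (0 <= t <= 1)%R ->
  (Cmod (a - c) < r)%R -> (Cmod (b - c) < r)%R -> (Cmod (a + RtoC t * (b - a) - c) < r)%R.
Proof.
  intros Ht Ha Hb.
  replace (a + RtoC t * (b - a) - c) with (RtoC (1 - t) * (a - c) + RtoC t * (b - c))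
    by (rewrite RtoC_minus; ring).
  eapply Rle_lt_trans; [apply Cmod_triangle|].
  rewrite !Cmod_mult, !Cmod_R, !Rabs_right by lra.
  destruct (Req_dec t 0) as [->|Hn]; [lra|]. nra.
Qed.

Section CauchyBounds.
Variables (h : C -> C) (a : C) (r M : R).
Hypothesis Hr : (0 < r)%R.
Hypothesis Hh : forall z, (Cmod (z - a) < r)%R -> exists k, is_cderive h z k.
Hypothesis HM : forall z, (Cmod (z - a) < r)%R -> (Cmod (h z) <= M)%R.

(** The estimate is applied on the circle of radius [r / 4] around [z], where
    [h] varies by at most [2 * M]. *)
Lemma Cauchy_derivative_bound (z l : C) :
  (Cmod (z - a) < r / 2)%R -> is_cderive h z l -> (Cmod l <= 8 * M / r)%R.
Proof.
  intros Hz Hl.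
  assert (Hin : forall w, (Cmod (w - z) < r / 2)%R -> (Cmod (w - a) < r)%R).
  { intros w Hw. assert (H := Cmod_minus_triangle w z a). lra. }
  replace (8 * M / r)%R with ((2 * M) / (r / 4))%R by (field; lra).
  apply (Cauchy_estimate h z l (r / 2)); [lra| |exact Hl|].
  - intros w Hw. apply Hh, Hin, Hw.
  - intros w Hw. eapply Rle_trans; [apply Cmod_triangle_minus|].
    assert (H1 := HM w (Hin w ltac:(lra))). assert (H2 := HM z ltac:(lra)). lra.
Qed.

Lemma Cauchy_Lipschitz (z w : C) :
  (Cmod (z - a) < r / 2)%R -> (Cmod (w - a) < r / 2)%R ->
  (Cmod (h z - h w) <= 8 * M / r * Cmod (z - w))%R.
Proof.
  intros Hz Hw. apply mean_value_inequality. intros t Ht.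
  assert (H := segment_ball w z a (r / 2) t Ht Hw Hz).
  destruct (Hh (w + RtoC t * (z - w))) as [l Hl]; [lra|].
  exists l. split; [exact Hl|]. eapply Cauchy_derivative_bound; eassumption.
Qed.

(** For fixed [w] the function [s |-> h (w + s) - h (a + s)] has derivative
    [h' w - h' a] at 0 and varies by [O(|w - a|)], since [h] is Lipschitz; the
    Cauchy estimate then makes [h'] Lipschitz at [a], and the mean value inequality
    integrates this. *)
Lemma Cauchy_second_order (z l : C) :
  (Cmod (z - a) < r / 4)%R -> is_cderive h a l ->
  (Cmod (h z - h a - l * (z - a)) <= 128 * M / r ^ 2 * Cmod (z - a) ^ 2)%R.
Proof.
  intros Hz Hl.
  assert (Haa : Cmod (a - a) = 0%R).
  { replace (a - a) with (RtoC 0) by ring. apply Cmod_0. }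
  assert (HMr : (0 <= 8 * M / r)%R).
  { apply Rle_mult_inv_pos; [|exact Hr]. assert (H1 := HM a ltac:(lra)). assert (H2 := Cmod_ge_0 (h a)). lra. }
  assert (Hder : forall w k, (Cmod (w - a) <= Cmod (z - a))%R -> is_cderive h w k ->
    (Cmod (k - l) <= 128 * M / r ^ 2 * Cmod (z - a))%R).
  { intros w k Hw Hk.
    (* [h] varies by at most [2 * (8 * M / r) * |w - a|] on the circle of radius [r / 8]. *)
    replace (128 * M / r ^ 2 * Cmod (z - a))%R with (2 * (8 * M / r * Cmod (z - a)) / (r / 8))%R by (field; lra).
    apply (Cauchy_estimate (fun s => h (w + s) - h (a + s)) 0 (k - l) (r / 4)); [lra| | |].
    - intros s Hs. replace (s - 0) with s in Hs by ring.
      destruct (Hh (w + s)) as [k1 Hk1].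
      { replace (w + s - a) with ((w - a) + s) by ring. eapply Rle_lt_trans; [apply Cmod_triangle|]. lra. }
      destruct (Hh (a + s)) as [k2 Hk2].
      { replace (a + s - a) with s by ring. lra. }
      eexists. apply is_cderive_minus; apply is_cderive_shift; eassumption.
    - apply is_cderive_minus; apply is_cderive_shift.
      + replace (w + 0) with w by ring. exact Hk.
      + replace (a + 0) with a by ring. exact Hl.
    - intros s Hs. replace (s - 0) with s in Hs by ring.
      assert (H1 := Cauchy_Lipschitz (w + s) (a + s)).
      assert (H2 := Cauchy_Lipschitz w a).
      replace (w + 0) with w by ring. replace (a + 0) with a by ring.
      replace (w + s - (a + s)) with (w - a) in H1 by ring.
      assert (H3 : (8 * M / r * Cmod (w - a) <= 8 * M / r * Cmod (z - a))%R) by (apply Rmult_le_compat_l; lra).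
      eapply Rle_trans; [apply Cmod_triangle_minus|].
      enough (Cmod (h (w + s) - h (a + s)) <= 8 * M / r * Cmod (w - a) /\ Cmod (h w - h a) <= 8 * M / r * Cmod (w - a))%R by lra.
      split; [apply H1|apply H2]; try lra.
      + replace (w + s - a) with ((w - a) + s) by ring. eapply Rle_lt_trans; [apply Cmod_triangle|]. lra.
      + replace (a + s - a) with s by ring. lra. }
  replace (h z - h a - l * (z - a)) with ((h z - l * z) - (h a - l * a)) by ring.
  replace (128 * M / r ^ 2 * Cmod (z - a) ^ 2)%R with (128 * M / r ^ 2 * Cmod (z - a) * Cmod (z - a))%R by ring.
  apply (mean_value_inequality (fun w => h w - l * w)). intros t Ht.
  set (w := a + RtoC t * (z - a)).
  assert (Hw : (Cmod (w - a) <= Cmod (z - a))%R).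
  { unfold w. replace (a + RtoC t * (z - a) - a) with (RtoC t * (z - a)) by ring.
    rewrite Cmod_mult, Cmod_R, Rabs_right by lra. assert (H := Cmod_ge_0 (z - a)). nra. }
  destruct (Hh w) as [k Hk]; [lra|].
  exists (k - l). split; [|apply (Hder w k Hw Hk)].
  apply is_cderive_minus; [exact Hk|].
  replace l with (0 * w + l * 1) at 2 by ring.
  apply is_cderive_mult; [apply is_cderive_const|apply is_cderive_id].
Qed.
End CauchyBounds.

(** The Cauchy estimate makes the derivatives at [a] converge at the same rate
    as the functions, and the second-order remainder is bounded independently of
    [n], so it passes to the limit. *)
Lemma telescoping_limit_derivable (u : nat -> C -> C) (v : C -> C) (b : nat -> R)
    (a : C) (r M : R) :
  (0 < r)%R ->
  (forall n z, (Cmod (z - a) < r)%R -> exists k, is_cderive (u n) z k) ->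
  (forall n z, (Cmod (z - a) < r)%R -> (Cmod (u n z) <= M)%R) ->
  (forall n z, (Cmod (z - a) < r)%R -> (Cmod (u (S n) z - u n z) <= b n - b (S n))%R) ->
  (forall n z, (Cmod (z - a) < r)%R -> (Cmod (u n z - v z) <= b n)%R) ->
  is_lim_seq b 0 ->
  exists l, is_cderive v a l.
Proof.
  intros Hr Hu HM Hd Hv Hb.
  assert (Haa : (Cmod (a - a) < r)%R).
  { replace (a - a) with (RtoC 0) by ring. rewrite Cmod_0. exact Hr. }
  set (d := fun n => C_derive (u n) a).
  assert (Hdn : forall n, is_cderive (u n) a (d n)).
  { intros n. destruct (Hu n a Haa) as [k Hk]. unfold d.
    rewrite (is_C_derive_unique _ _ _ Hk). exact Hk. }
  destruct (telescoping_limit d (fun n => 4 / r * b n)%R) as [l Hl].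
  { intros n. replace (4 / r * b n - 4 / r * b (S n))%R with (2 * (b n - b (S n)) / (r / 2))%R by (field; lra).
    apply (Cauchy_estimate (fun z => u (S n) z - u n z) a _ r); [lra| | |].
    - intros z Hz. destruct (Hu n z Hz) as [k Hk]. destruct (Hu (S n) z Hz) as [k' Hk'].
      eexists. apply is_cderive_minus; eassumption.
    - apply is_cderive_minus; apply Hdn.
    - intros z Hz. eapply Rle_trans; [apply Cmod_triangle_minus|].
      assert (H1 := Hd n z ltac:(lra)). assert (H2 := Hd n a Haa). lra. }
  { replace (Finite 0) with (Rbar_mult (4 / r)%R 0) by (simpl; f_equal; ring).
    apply is_lim_seq_scal_l. exact Hb. }
  exists l.
  set (K := (128 * M / r ^ 2)%R).
  assert (HK : (0 <= K)%R).
  { apply Rle_mult_inv_pos; [|apply pow_lt; exact Hr].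
    assert (H1 := HM 0%nat a Haa). assert (H2 := Cmod_ge_0 (u 0%nat a)). lra. }
  assert (H2nd : forall z, (Cmod (z - a) < r / 4)%R ->
    (Cmod (v z - v a - l * (z - a)) <= K * Cmod (z - a) ^ 2)%R).
  { intros z Hz. apply le_epsilon. intros eps He.
    assert (Hr4 : (0 < 4 / r)%R) by (apply Rdiv_lt_0_compat; lra).
    assert (HN : exists n, (b n < eps / 3)%R).
    { destruct (proj1 (is_lim_seq_Reals b 0) Hb (eps / 3)%R ltac:(lra)) as [N HN].
      exists N. specialize (HN N (le_n N)). unfold R_dist in HN.
      rewrite Rminus_0_r in HN. apply Rabs_def2 in HN. lra. }
    destruct HN as [n Hn].
    assert (H1 := Cauchy_second_order (u n) a r M Hr (Hu n) (HM n) z (d n) Hz (Hdn n)).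
    fold K in H1.
    assert (H2 := Hv n z ltac:(lra)). assert (H3 := Hv n a Haa). specialize (Hl n).
    replace (v z - v a - l * (z - a)) with
      ((u n z - u n a - d n * (z - a)) - (u n z - v z) + ((u n a - v a) + (d n - l) * (z - a))) by ring.
    eapply Rle_trans; [apply Cmod_triangle|].
    assert (T1 := Cmod_triangle_minus (u n z - u n a - d n * (z - a)) (u n z - v z)).
    assert (T2 := Cmod_triangle (u n a - v a) ((d n - l) * (z - a))).
    rewrite Cmod_mult in T2.
    assert (T3 : (Cmod (d n - l) * Cmod (z - a) <= b n)%R).
    { apply Rle_trans with (4 / r * b n * (r / 4))%R; [|right; field; lra].
      apply Rmult_le_compat; try apply Cmod_ge_0; lra. }
    lra. }
  apply is_cderive_Cmod. intros eps He.
  assert (0 < eps / (K + 1))%R by (apply Rdiv_lt_0_compat; lra).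
  exists (Rmin (r / 4) (eps / (K + 1))). split; [apply Rmin_pos; lra|].
  intros z Hz.
  assert (Hz1 := Rlt_le_trans _ _ _ Hz (Rmin_l _ _)).
  assert (Hz2 := Rlt_le_trans _ _ _ Hz (Rmin_r _ _)).
  eapply Rle_trans; [apply H2nd, Hz1|].
  assert (Hp := Cmod_ge_0 (z - a)).
  replace (K * Cmod (z - a) ^ 2)%R with (K * Cmod (z - a) * Cmod (z - a))%R by ring.
  apply Rmult_le_compat_r; [exact Hp|].
  apply (Rmult_lt_compat_l (K + 1)) in Hz2; [|lra].
  replace ((K + 1) * (eps / (K + 1)))%R with eps in Hz2 by (field; lra). lra.
Qed.

(** * Local inverses *)

Lemma le_of_lim_0 (b : nat -> R) (x y : R) :
  is_lim_seq b 0 -> (forall n, x <= y + b n)%R -> (x <= y)%R.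
Proof.
  intros Hb H.
  assert (Hle : Rbar_le (x - y)%R 0).
  { apply (is_lim_seq_le (fun _ => (x - y)%R) b).
    - intros n. specialize (H n). lra.
    - apply is_lim_seq_const.
    - exact Hb. }
  simpl in Hle. lra.
Qed.

Lemma is_lim_seq_scal_0 (k : R) (b : nat -> R) :
  is_lim_seq b 0 -> is_lim_seq (fun n => k * b n)%R 0.
Proof.
  intros Hb. replace (Finite 0) with (Rbar_mult k 0) by (simpl; f_equal; ring).
  apply is_lim_seq_scal_l, Hb.
Qed.

(** Near the origin [f] is the identity plus a contraction, so [f z = w] is
    solved by iterating [z |-> w - (f z - z)], and [f] expands distances by at least
    1/2, which makes the inverse Lipschitz and hence differentiable. *)
Section InverseFunction.
Variables (U : C -> Prop) (f : C -> C) (r : R).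
Hypothesis Hr : (0 < r)%R.
Hypothesis HU : forall z : C, (Cmod z < r)%R -> U z.
Hypothesis Hf : holomorphic_on U f.
Hypothesis Hf0 : f 0 = 0.
Hypothesis Hlip : forall z w : C, (Cmod z < r)%R -> (Cmod w < r)%R ->
  (Cmod ((f z - z) - (f w - w)) <= 1 / 2 * Cmod (z - w))%R.

Let expanding (z w : C) : (Cmod z < r)%R -> (Cmod w < r)%R ->
  (Cmod (z - w) <= 2 * Cmod (f z - f w))%R.
Proof.
  intros Hz Hw. assert (H := Hlip z w Hz Hw).
  assert (T := Cmod_triangle_minus (f z - f w) ((f z - z) - (f w - w))).
  replace (f z - f w - (f z - z - (f w - w))) with (z - w) in T by ring. lra.
Qed.

Let preimage (w : C) : (Cmod w < r / 2)%R ->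
  exists z : C, (Cmod z <= 2 * Cmod w)%R /\ f z = w.
Proof.
  intros Hw.
  set (u := fun n => Nat.iter n (fun z => w - (f z - z)) 0).
  assert (Hw0 := Cmod_ge_0 w).
  assert (Hu : forall n, (Cmod (u n) <= 2 * Cmod w)%R).
  { induction n as [|n IH].
    - change (u 0%nat) with (RtoC 0). rewrite Cmod_0. lra.
    - change (u (S n)) with (w - (f (u n) - u n)).
      eapply Rle_trans; [apply Cmod_triangle_minus|].
      assert (H := Hlip (u n) 0 ltac:(lra) ltac:(rewrite Cmod_0; exact Hr)).
      rewrite Hf0 in H. replace (f (u n) - u n - (0 - 0)) with (f (u n) - u n) in H by ring.
      replace (u n - 0) with (u n) in H by ring. lra. }
  set (b := fun n => (2 * Cmod w * (1 / 2) ^ n)%R).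
  assert (Hb : is_lim_seq b 0).
  { apply is_lim_seq_scal_0, is_lim_seq_geom. rewrite Rabs_right; lra. }
  destruct (telescoping_limit u b) as [l Hl]; [|exact Hb|].
  { intros n. unfold b. cbn [pow].
    replace (2 * Cmod w * (1 / 2) ^ n - 2 * Cmod w * (1 / 2 * (1 / 2) ^ n))%R with (Cmod w * (1 / 2) ^ n)%R by field.
    induction n as [|n IH].
    - change (u 1%nat) with (w - (f 0 - 0)). change (u 0%nat) with (RtoC 0). rewrite Hf0.
      simpl. rewrite Rmult_1_r. right. f_equal. ring.
    - change (u (S (S n)) - u (S n)) with
        ((w - (f (u (S n)) - u (S n))) - (w - (f (u n) - u n))).
      replace ((w - (f (u (S n)) - u (S n))) - (w - (f (u n) - u n))) with
        ((f (u n) - u n) - (f (u (S n)) - u (S n))) by ring.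
      assert (H1 := Hu n). assert (H2 := Hu (S n)).
      eapply Rle_trans; [apply Hlip; lra|]. rewrite Cmod_minus_sym. cbn [pow]. lra. }
  assert (Hl2 : (Cmod l <= 2 * Cmod w)%R).
  { apply (le_of_lim_0 b); [exact Hb|]. intros n.
    assert (T := Cmod_triangle_minus (u n) (u n - l)).
    replace (u n - (u n - l)) with l in T by ring. specialize (Hu n). specialize (Hl n). lra. }
  exists l. split; [exact Hl2|].
  assert (E : (Cmod (f l - w) <= 0)%R).
  { apply (le_of_lim_0 (fun n => 2 * b n)%R); [apply is_lim_seq_scal_0, Hb|]. intros n.
    rewrite Rplus_0_l.
    replace (f l - w) with (((f l - l) - (f (u n) - u n)) - (u (S n) - l)).
    2:{ change (u (S n)) with (w - (f (u n) - u n)). ring. }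
    eapply Rle_trans; [apply Cmod_triangle_minus|].
    assert (H1 := Hu n). assert (H2 := Hlip l (u n) ltac:(lra) ltac:(lra)).
    assert (H3 := Hl n). assert (H4 := Hl (S n)). rewrite Cmod_minus_sym in H3.
    assert (H5 : (0 <= b n)%R) by (eapply Rle_trans; [apply Cmod_ge_0|exact H3]).
    assert (H6 : (b (S n) = 1 / 2 * b n)%R) by (unfold b; simpl; ring). lra. }
  assert (E' : f l - w = 0) by (apply Cmod_eq_0, Rle_antisym; [exact E|apply Cmod_ge_0]).
  replace (f l) with (f l - w + w) by ring. rewrite E'. ring.
Qed.

Lemma local_inverse_exists : exists (W : C -> Prop) (g : C -> C), local_inverse U f W g.
Proof.
  set (W := fun w : C => (Cmod w < r / 2)%R).
  set (g := fun w : C => epsilon (inhabits (RtoC 0)) (fun z : C => (Cmod z <= 2 * Cmod w)%R /\ f z = w)).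
  assert (Hg : forall w, W w -> (Cmod (g w) <= 2 * Cmod w)%R /\ f (g w) = w).
  { intros w Hw. apply epsilon_spec, preimage, Hw. }
  assert (Hgr : forall w, W w -> (Cmod (g w) < r)%R).
  { intros w Hw. destruct (Hg w Hw) as [H _]. unfold W in Hw. lra. }
  assert (HWopen : forall w, W w -> exists d, (0 < d)%R /\ forall y, (Cmod (y - w) < d)%R -> W y).
  { intros w Hw. unfold W in *. exists (r / 2 - Cmod w)%R. split; [lra|]. intros y Hy.
    assert (T := Cmod_triangle (y - w) w). replace (y - w + w) with y in T by ring. lra. }
  assert (HW0 : W 0) by (unfold W; rewrite Cmod_0; lra).
  exists W, g. split.
  - intros w Hw. apply locally_C_Cmod, HWopen, Hw.
  - exact HW0.
  - apply Cmod_eq_0, Rle_antisym; [|apply Cmod_ge_0].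
    destruct (Hg 0 HW0) as [H _]. rewrite Cmod_0 in H. lra.
  - apply holomorphic_on_is_cderive. intros w Hw. destruct (HWopen w Hw) as [d0 [Hd0 HWd]].
    destruct (proj1 (holomorphic_on_is_cderive U f) Hf (g w)) as [l Hl]; [apply HU, Hgr, Hw|].
    (* A vanishing derivative would contradict the expansion of distances. *)
    assert (Hl0 : l <> 0).
    { intros ->. destruct (proj1 (is_cderive_Cmod _ _ _) Hl (1 / 4)%R ltac:(lra)) as [d [Hd H]].
      assert (Hgw := Hgr w Hw).
      set (s := (Rmin d (r - Cmod (g w)) / 2)%R).
      assert (Hs : (0 < s < d /\ s < r - Cmod (g w))%R).
      { unfold s. assert (H1 := Rmin_l d (r - Cmod (g w))). assert (H2 := Rmin_r d (r - Cmod (g w))).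
        assert (H3 : (0 < Rmin d (r - Cmod (g w)))%R) by (apply Rmin_pos; lra). lra. }
      specialize (H (g w + RtoC s)). replace (g w + RtoC s - g w) with (RtoC s) in H by ring.
      assert (Hms : Cmod (RtoC s) = s) by (rewrite Cmod_R; apply Rabs_right; lra).
      rewrite Hms in H. specialize (H ltac:(lra)).
      assert (Hex := expanding (g w + RtoC s) (g w)).
      replace (g w + RtoC s - g w) with (RtoC s) in Hex by ring. rewrite Hms in Hex.
      assert (T := Cmod_triangle (g w) (RtoC s)). rewrite Hms in T.
      specialize (Hex ltac:(lra) Hgw).
      replace (f (g w + RtoC s) - f (g w) - 0 * RtoC s) with (f (g w + RtoC s) - f (g w)) in H by ring.
      lra. }
    exists (/ l). apply is_cderive_Cmod. intros eps He.
    assert (Hlp := proj1 (Cmod_gt_0 l) Hl0).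
    destruct (proj1 (is_cderive_Cmod _ _ _) Hl (eps * Cmod l / 2)%R) as [d [Hd H]].
    { apply Rdiv_lt_0_compat; [apply Rmult_lt_0_compat; assumption|lra]. }
    exists (Rmin d0 (d / 2)). split; [apply Rmin_pos; lra|]. intros y Hy.
    assert (Hy1 := Rlt_le_trans _ _ _ Hy (Rmin_l _ _)).
    assert (Hy2 := Rlt_le_trans _ _ _ Hy (Rmin_r _ _)).
    assert (HWy := HWd y Hy1).
    assert (Hex := expanding (g y) (g w) (Hgr y HWy) (Hgr w Hw)).
    rewrite (proj2 (Hg y HWy)), (proj2 (Hg w Hw)) in Hex.
    specialize (H (g y) ltac:(lra)). rewrite (proj2 (Hg y HWy)), (proj2 (Hg w Hw)) in H.
    replace (g y - g w - / l * (y - w)) with (/ l * - (y - w - l * (g y - g w))) by (field; exact Hl0).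
    rewrite Cmod_mult, Cmod_opp, Cmod_inv by exact Hl0.
    apply (Rmult_le_reg_l (Cmod l)); [exact Hlp|].
    rewrite <- Rmult_assoc, Rinv_r, Rmult_1_l by lra.
    eapply Rle_trans; [exact H|].
    apply Rle_trans with (eps * Cmod l / 2 * (2 * Cmod (y - w)))%R; [|right; field].
    apply Rmult_le_compat_l; [|exact Hex]. 
    apply Rle_mult_inv_pos; [apply Rmult_le_pos; lra|lra].
  - intros w Hw. split; [apply HU, Hgr, Hw|apply (Hg w Hw)].
  - apply locally_C_Cmod. exists (r / 4)%R. split; [lra|]. intros z Hz.
    replace (z - 0) with z in Hz by ring.
    assert (H := Hlip z 0 ltac:(lra) ltac:(rewrite Cmod_0; exact Hr)).
    rewrite Hf0 in H. replace (f z - z - (0 - 0)) with (f z - z) in H by ring.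
    replace (z - 0) with z in H by ring.
    assert (T := Cmod_triangle (f z - z) z). replace (f z - z + z) with (f z) in T by ring.
    assert (HWf : W (f z)) by (unfold W; lra).
    assert (Hex := expanding (g (f z)) z (Hgr _ HWf) ltac:(lra)).
    rewrite (proj2 (Hg _ HWf)) in Hex.
    replace (f z - f z) with (RtoC 0) in Hex by ring. rewrite Cmod_0, Rmult_0_r in Hex.
    assert (E : g (f z) - z = 0) by (apply Cmod_eq_0, Rle_antisym; [exact Hex|apply Cmod_ge_0]).
    replace (g (f z)) with (g (f z) - z + z) by ring. rewrite E. ring.
Qed.
End InverseFunction.

(** * Maps close to a translation on a half-plane *)

Lemma Re_le_Cmod (z : C) : (Re z <= Cmod z)%R.
Proof. eapply Rle_trans; [apply Rle_abs|apply re_le_Cmod]. Qed.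

Lemma Re_near (z w : C) : (Re w - Cmod (z - w) <= Re z)%R.
Proof.
  assert (H := Re_le_Cmod (w - z)). rewrite Cmod_minus_sym in H.
  change (Re (w - z)) with (Re w - Re z)%R in H. lra.
Qed.

Lemma Rinv_le_mult (a b : R) : (0 < b)%R -> (1 <= a * b)%R -> (/ b <= a)%R.
Proof.
  intros Hb H. apply (Rmult_le_reg_r b); [exact Hb|]. rewrite Rinv_l by lra. exact H.
Qed.

(** The constants: on [Re >= x] the defect [F z - (z - 1)] is Lipschitz with
    constant [16 * A / x^2], and the sum of these over [x, x + 1, ...] is at most
    half of [32 * A / (x - 1)].  The last condition on [X] makes the latter at most
    1, so that the infinite product of the Lipschitz factors is bounded by
    1 plus that quantity. *)
Section Translation.
Variables (F : C -> C) (X0 A X : R).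
Hypothesis A_pos : (0 <= A)%R.
Hypothesis F_derivable : forall z : C, (X0 < Re z)%R -> exists l, is_cderive F z l.
Hypothesis F_translation : forall z : C, (X0 < Re z)%R ->
  (Cmod (F z - (z - 1)) <= A / Cmod z ^ 2)%R.
Hypothesis X_large : (X0 + 2 <= X /\ 3 <= X /\ 32 * A <= X - 1)%R.

Let defect_bound (z : C) (x : R) : (X0 < x)%R -> (0 < x)%R -> (x <= Re z)%R ->
  (Cmod (F z - (z - 1)) <= A / x ^ 2)%R.
Proof.
  intros Hx Hx0 Hz. eapply Rle_trans; [apply F_translation; lra|].
  assert (H := Re_le_Cmod z).
  apply Rmult_le_compat_l; [exact A_pos|]. apply Rinv_le_contravar; [apply pow_lt; exact Hx0|].
  apply pow_incr. lra.
Qed.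

(** Cauchy's estimate on disks of radius 1/2 around the points of the segment,
    which stay in [Re > x - 1]; the mean value inequality applies because half-planes are
    convex. *)
Let defect_Lipschitz (x : R) (z w : C) : (X <= x)%R -> (x <= Re z)%R -> (x <= Re w)%R ->
  (Cmod (F z - F w - (z - w)) <= 16 * A / x ^ 2 * Cmod (z - w))%R.
Proof.
  intros Hx Hz Hw.
  replace (F z - F w - (z - w)) with ((F z - (z - 1)) - (F w - (w - 1))) by ring.
  apply (mean_value_inequality (fun s => F s - (s - 1))). intros t Ht.
  set (p := w + RtoC t * (z - w)).
  assert (Hp : (x <= Re p)%R).
  { unfold p. destruct z as [zx zy], w as [wx wy]. simpl in *. nra. }
  destruct (F_derivable p) as [l Hl]; [lra|].
  assert (Hd : is_cderive (fun s => F s - (s - 1)) p (l - (1 - 0))).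
  { apply is_cderive_minus; [exact Hl|]. apply is_cderive_minus; [apply is_cderive_id|apply is_cderive_const]. }
  exists (l - (1 - 0)). split; [exact Hd|].
  assert (Hball : forall s : C, (Cmod (s - p) < 1)%R -> (x - 1 < Re s)%R).
  { intros s Hs. assert (H := Re_near s p). lra. }
  assert (HA : (A / (x - 1) ^ 2 <= 4 * A / x ^ 2)%R).
  { unfold Rdiv. rewrite (Rmult_comm 4), Rmult_assoc. apply Rmult_le_compat_l; [exact A_pos|].
    apply Rinv_le_mult; [apply pow_lt; lra|].
    apply (Rmult_le_reg_r (x ^ 2)); [apply pow_lt; lra|].
    replace (4 * / x ^ 2 * (x - 1) ^ 2 * x ^ 2)%R with (4 * (x - 1) ^ 2)%R by (field; lra). nra. }
  replace (16 * A / x ^ 2)%R with (2 * (4 * A / x ^ 2) / (1 / 2))%R by (field; lra).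
  apply (Cauchy_estimate (fun s => F s - (s - 1)) p _ 1); [lra| |exact Hd|].
  - intros s Hs. destruct (F_derivable s) as [k Hk]; [specialize (Hball s Hs); lra|].
    eexists. apply is_cderive_minus; [exact Hk|].
    apply is_cderive_minus; [apply is_cderive_id|apply is_cderive_const].
  - intros s Hs. eapply Rle_trans; [apply Cmod_triangle_minus|].
    assert (H1 := defect_bound s (x - 1) ltac:(lra) ltac:(lra) ltac:(specialize (Hball s ltac:(lra)); lra)).
    assert (H2 := defect_bound p (x - 1) ltac:(lra) ltac:(lra) ltac:(lra)). lra.
Qed.

(** The map [phi_ f n] in the coordinate [1 / z]. *)
Definition conjugate_iterate (n : nat) (z : C) : C := Nat.iter n F (z + RtoC (INR n)).

Lemma conjugate_iterate_S (n : nat) (z : C) :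
  conjugate_iterate (S n) z = F (conjugate_iterate n (z + 1)).
Proof.
  unfold conjugate_iterate. rewrite S_INR, RtoC_plus. simpl Nat.iter. do 2 f_equal. ring.
Qed.

Let Re_plus_1 (z : C) : Re (z + 1) = (Re z + 1)%R.
Proof. reflexivity. Qed.

(** The bound [A / (x - 1)] dominates the sum of the defects [A / y^2] met along
    the orbit, [y = x, x + 1, ...], since [1 / x^2 + 1 / x <= 1 / (x - 1)]. *)
Lemma conjugate_iterate_near (n : nat) (z : C) : (X <= Re z)%R ->
  (Cmod (conjugate_iterate n z - z) <= A / (Re z - 1))%R.
Proof.
  revert z. induction n as [|n IH]; intros z Hz.
  - unfold conjugate_iterate. simpl. replace (z + 0 - z) with (RtoC 0) by ring.
    rewrite Cmod_0. apply Rle_mult_inv_pos; lra.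
  - rewrite conjugate_iterate_S. specialize (IH (z + 1)). rewrite Re_plus_1 in IH.
    specialize (IH ltac:(lra)).
    set (p := conjugate_iterate n (z + 1)) in *. set (x := Re z) in *.
    replace (x + 1 - 1)%R with x in IH by ring.
    assert (HAx : (A / x <= 1)%R).
    { apply (Rmult_le_reg_r x); [lra|]. unfold Rdiv. rewrite Rmult_assoc, Rinv_l by lra. lra. }
    assert (Hp : (x <= Re p)%R).
    { assert (H := Re_near p (z + 1)). rewrite Re_plus_1 in H. fold x in H. lra. }
    assert (H1 := defect_bound p x ltac:(lra) ltac:(lra) Hp).
    replace (F p - z) with ((F p - (p - 1)) + (p - (z + 1))) by ring.
    eapply Rle_trans; [apply Cmod_triangle|].
    apply Rle_trans with (A / x ^ 2 + A / x)%R; [lra|].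
    replace (A / x ^ 2 + A / x)%R with (A * ((x + 1) / x ^ 2))%R by (field; lra).
    apply Rmult_le_compat_l; [exact A_pos|].
    apply (Rmult_le_reg_r (x ^ 2 * (x - 1))); [apply Rmult_lt_0_compat; [apply pow_lt|]; lra|].
    replace ((x + 1) / x ^ 2 * (x ^ 2 * (x - 1)))%R with (x ^ 2 - 1)%R by (field; lra).
    replace (/ (x - 1) * (x ^ 2 * (x - 1)))%R with (x ^ 2)%R by (field; lra). lra.
Qed.

Lemma conjugate_iterate_half (n : nat) (z : C) : (X <= Re z)%R ->
  (Cmod (conjugate_iterate n z - z) <= 1 / 2)%R.
Proof.
  intros Hz. eapply Rle_trans; [apply conjugate_iterate_near, Hz|].
  apply (Rmult_le_reg_r (Re z - 1)); [lra|]. unfold Rdiv. rewrite Rmult_assoc, Rinv_l by lra. lra.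
Qed.

Let Re_iterate (n : nat) (z : C) (x : R) : (X <= x)%R -> (x <= Re z)%R ->
  (x <= Re (conjugate_iterate n (z + 1)))%R.
Proof.
  intros Hx Hz. assert (H := Re_near (conjugate_iterate n (z + 1)) (z + 1)).
  assert (H1 := conjugate_iterate_half n (z + 1)). rewrite Re_plus_1 in *.
  specialize (H1 ltac:(lra)). lra.
Qed.

(** [1 + growth x] bounds the product of the Lipschitz factors
    [1 + 16 * A / y^2] over [y = x, x + 1, ...]; [growth_step] is the corresponding
    one-step inequality. *)
Let growth (x : R) : R := (32 * A / (x - 1))%R.

Let growth_step (x : R) : (X <= x)%R ->
  ((1 + 16 * A / x ^ 2) * (1 + growth (x + 1)) <= 1 + growth x)%R.
Proof.
  intros Hx. unfold growth. replace (x + 1 - 1)%R with x by ring.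
  apply (Rmult_le_reg_r (x ^ 3 * (x - 1))); [apply Rmult_lt_0_compat; [apply pow_lt|]; lra|].
  replace ((1 + 16 * A / x ^ 2) * (1 + 32 * A / x) * (x ^ 3 * (x - 1)))%R with
    ((x ^ 2 + 16 * A) * (x + 32 * A) * (x - 1))%R by (field; lra).
  replace ((1 + 32 * A / (x - 1)) * (x ^ 3 * (x - 1)))%R with (x ^ 3 * (x - 1 + 32 * A))%R by (field; lra).
  assert (H : (0 <= A * x * (x - 32 * A))%R) by (repeat apply Rmult_le_pos; lra).
  assert (H1 : (0 <= A * x * x)%R) by (repeat apply Rmult_le_pos; lra).
  assert (H2 : (0 <= A * A)%R) by (repeat apply Rmult_le_pos; lra).
  assert (H3 : (0 <= A * x)%R) by (repeat apply Rmult_le_pos; lra).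
  assert (H4 : (0 <= A * x * x * (x - 32 * A))%R) by (repeat apply Rmult_le_pos; lra).
  nra.
Qed.

Let growth_bound (x : R) : (X <= x)%R -> (0 <= growth x <= 1)%R.
Proof.
  intros Hx. unfold growth. split; [apply Rle_mult_inv_pos; lra|].
  apply (Rmult_le_reg_r (x - 1)); [lra|]. unfold Rdiv. rewrite Rmult_assoc, Rinv_l by lra. lra.
Qed.
(** Each [conjugate_iterate n] is the identity up to a map of Lipschitz constant
    [growth x < 1], uniformly in [n]; this survives in the limit and gives
    injectivity. *)
Lemma conjugate_iterate_spread (n : nat) (z w : C) : (X <= Re z)%R -> (X <= Re w)%R ->
  (Cmod (conjugate_iterate n z - conjugate_iterate n w - (z - w)) <=
     growth (Rmin (Re z) (Re w)) * Cmod (z - w))%R.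
Proof.
  revert z w. induction n as [|n IH]; intros z w Hz Hw.
  - unfold conjugate_iterate. simpl. replace (z + 0 - (w + 0) - (z - w)) with (RtoC 0) by ring.
    rewrite Cmod_0. apply Rmult_le_pos; [|apply Cmod_ge_0].
    apply growth_bound, Rmin_glb; assumption.
  - rewrite !conjugate_iterate_S. set (x := Rmin (Re z) (Re w)).
    assert (Hx : (X <= x)%R) by (apply Rmin_glb; assumption).
    assert (Hxz : (x <= Re z)%R) by apply Rmin_l.
    assert (Hxw : (x <= Re w)%R) by apply Rmin_r.
    specialize (IH (z + 1) (w + 1)). rewrite !Re_plus_1 in IH.
    specialize (IH ltac:(lra) ltac:(lra)).
    replace (Rmin (Re z + 1) (Re w + 1)) with (x + 1)%R in IH.
    2:{ unfold x, Rmin. destruct (Rle_dec (Re z) (Re w)); destruct (Rle_dec (Re z + 1) (Re w + 1)); lra. }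
    replace (z + 1 - (w + 1)) with (z - w) in IH by ring.
    assert (Hp := Re_iterate n z x Hx Hxz). assert (Hq := Re_iterate n w x Hx Hxw).
    set (p := conjugate_iterate n (z + 1)) in *. set (q := conjugate_iterate n (w + 1)) in *.
    assert (HL := defect_Lipschitz x p q Hx Hp Hq).
    assert (Hstep := growth_step x Hx).
    replace (F p - F q - (z - w)) with ((F p - F q - (p - q)) + (p - q - (z - w))) by ring.
    eapply Rle_trans; [apply Cmod_triangle|].
    assert (T := Cmod_triangle (p - q - (z - w)) (z - w)).
    replace (p - q - (z - w) + (z - w)) with (p - q) in T by ring.
    set (k := (16 * A / x ^ 2)%R) in *.
    assert (Hk : (0 <= k)%R) by (apply Rle_mult_inv_pos; [lra|apply pow_lt; lra]).
    assert (HD := Cmod_ge_0 (z - w)).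
    assert (T1 : (k * Cmod (p - q) <= k * ((growth (x + 1) + 1) * Cmod (z - w)))%R).
    { apply Rmult_le_compat_l; lra. }
    assert (T2 : (((1 + k) * (1 + growth (x + 1))) * Cmod (z - w) <= (1 + growth x) * Cmod (z - w))%R).
    { apply Rmult_le_compat_r; lra. }
    lra.
Qed.

(** The case [n = 0] is the defect of [F] at [z + 1]; each further step moves to
    [z + 1] and costs one Lipschitz factor. *)
Lemma conjugate_iterate_increment (n : nat) (z : C) : (X <= Re z)%R ->
  (Cmod (conjugate_iterate (S n) z - conjugate_iterate n z) <=
     A * (1 + growth (Re z)) / Cmod (z + RtoC (INR n + 1)) ^ 2)%R.
Proof.
  revert z. induction n as [|n IH]; intros z Hz.
  - rewrite conjugate_iterate_S. unfold conjugate_iterate. simpl Nat.iter. simpl INR.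
    replace (z + 1 + RtoC 0) with (z + 1) by ring. replace (z + RtoC 0) with z by ring.
    rewrite Rplus_0_l.
    assert (H := F_translation (z + 1)). rewrite Re_plus_1 in H. specialize (H ltac:(lra)).
    replace (z + 1 - 1) with z in H by ring.
    eapply Rle_trans; [exact H|]. unfold Rdiv. rewrite Rmult_assoc.
    apply Rmult_le_compat_l; [exact A_pos|].
    assert (Hg := growth_bound (Re z) Hz).
    assert (Hi : (0 < Cmod (z + 1))%R).
    { assert (H1 := Re_le_Cmod (z + 1)). rewrite Re_plus_1 in H1. lra. }
    assert (Hi2 : (0 < / Cmod (z + 1) ^ 2)%R) by (apply Rinv_0_lt_compat, pow_lt; exact Hi). nra.
  - rewrite (conjugate_iterate_S (S n) z), (conjugate_iterate_S n z).
    specialize (IH (z + 1)). rewrite Re_plus_1 in IH. specialize (IH ltac:(lra)).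
    replace (z + 1 + RtoC (INR n + 1)) with (z + RtoC (INR (S n) + 1)) in IH.
    2:{ rewrite S_INR, !RtoC_plus. ring. }
    set (x := Re z) in *. set (D := Cmod (z + RtoC (INR (S n) + 1))) in *.
    assert (HD : (0 < D)%R).
    { assert (H1 := Re_le_Cmod (z + RtoC (INR (S n) + 1))). fold D in H1.
      change (Re (z + RtoC (INR (S n) + 1))) with (x + (INR (S n) + 1))%R in H1.
      assert (H2 := pos_INR (S n)). lra. }
    assert (Hp := Re_iterate (S n) z x Hz (Rle_refl x)). assert (Hq := Re_iterate n z x Hz (Rle_refl x)).
    set (p := conjugate_iterate (S n) (z + 1)) in *. set (q := conjugate_iterate n (z + 1)) in *.
    assert (HL := defect_Lipschitz x p q Hz Hp Hq).
    assert (Hstep := growth_step x Hz).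
    replace (F p - F q) with ((F p - F q - (p - q)) + (p - q)) by ring.
    eapply Rle_trans; [apply Cmod_triangle|].
    set (k := (16 * A / x ^ 2)%R) in *.
    assert (Hk : (0 <= k)%R) by (apply Rle_mult_inv_pos; [lra|apply pow_lt; lra]).
    assert (T1 : ((1 + k) * Cmod (p - q) <= (1 + k) * (A * (1 + growth (x + 1)) / D ^ 2))%R).
    { apply Rmult_le_compat_l; lra. }
    apply Rle_trans with ((1 + k) * (A * (1 + growth (x + 1)) / D ^ 2))%R; [lra|].
    replace ((1 + k) * (A * (1 + growth (x + 1)) / D ^ 2))%R with
      (A / D ^ 2 * ((1 + k) * (1 + growth (x + 1))))%R by (field; lra).
    replace (A * (1 + growth x) / D ^ 2)%R with (A / D ^ 2 * (1 + growth x))%R by (field; lra).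
    apply Rmult_le_compat_l; [|exact Hstep].
    apply Rle_mult_inv_pos; [exact A_pos|apply pow_lt; exact HD].
Qed.

Lemma conjugate_iterate_step (n : nat) (z : C) : (X <= Re z)%R ->
  (Cmod (conjugate_iterate (S n) z - conjugate_iterate n z) <=
     2 * A / Cmod (z + RtoC (INR n + 1)) ^ 2)%R.
Proof.
  intros Hz. eapply Rle_trans; [apply conjugate_iterate_increment, Hz|].
  assert (Hn := pos_INR n).
  assert (H1 := Re_le_Cmod (z + RtoC (INR n + 1))).
  change (Re (z + RtoC (INR n + 1))) with (Re z + (INR n + 1))%R in H1.
  apply Rmult_le_compat_r; [left; apply Rinv_0_lt_compat, pow_lt; lra|].
  assert (Hg := growth_bound (Re z) Hz). nra.
Qed.

(** A telescoping majorant of the sum of [2 * A / (X + k + 1)^2] over [k >= n]. *)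
Let tail (n : nat) : R := (2 * A / (X + INR n))%R.

Let tail_lim : is_lim_seq tail 0.
Proof.
  apply is_lim_seq_scal_0.
  apply (is_lim_seq_inv (fun n => X + INR n)%R p_infty); [|discriminate].
  apply (is_lim_seq_plus _ _ X p_infty); [apply is_lim_seq_const|apply is_lim_seq_INR|reflexivity].
Qed.

Let tail_step (n : nat) (z : C) : (X <= Re z)%R ->
  (Cmod (conjugate_iterate (S n) z - conjugate_iterate n z) <= tail n - tail (S n))%R.
Proof.
  intros Hz. eapply Rle_trans; [apply conjugate_iterate_step, Hz|].
  assert (Hn := pos_INR n).
  assert (H1 := Re_le_Cmod (z + RtoC (INR n + 1))).
  change (Re (z + RtoC (INR n + 1))) with (Re z + (INR n + 1))%R in H1.
  unfold tail. rewrite S_INR. set (y := (X + INR n)%R).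
  replace (2 * A / y - 2 * A / (X + (INR n + 1)))%R with (2 * A / (y * (y + 1)))%R.
  2:{ unfold y. field. lra. }
  apply Rmult_le_compat_l; [lra|]. apply Rinv_le_contravar.
  - apply Rmult_lt_0_compat; unfold y; lra.
  - apply Rle_trans with ((y + 1) ^ 2)%R; [unfold y; nra|].
    apply pow_incr. unfold y. lra.
Qed.

Let conjugate_iterate_derivable (n : nat) (z : C) : (X <= Re z)%R ->
  exists l, is_cderive (conjugate_iterate n) z l.
Proof.
  revert z. induction n as [|n IH]; intros z Hz.
  - eexists. apply is_cderive_plus; [apply is_cderive_id|apply is_cderive_const].
  - destruct (IH (z + 1)) as [l Hl]; [rewrite Re_plus_1; lra|].
    destruct (F_derivable (conjugate_iterate n (z + 1))) as [k Hk].
    { assert (H := Re_iterate n z (Re z) Hz (Rle_refl _)). lra. }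
    eexists. apply (is_cderive_ext_loc (fun w => F (conjugate_iterate n (w + 1))) _ _ _ 1); [lra| |].
    + intros w _. symmetry. apply conjugate_iterate_S.
    + apply is_cderive_comp; [exact Hk|].
      apply (is_cderive_comp (conjugate_iterate n) (fun w => w + 1)); [exact Hl|].
      apply is_cderive_plus; [apply is_cderive_id|apply is_cderive_const].
Qed.

Theorem conjugation_to_translation : exists Phi : C -> C,
  (forall z : C, (X <= Re z)%R ->
     filterlim (fun n => conjugate_iterate n z) eventually (locally (Phi z))) /\
  (forall z : C, (X <= Re z)%R -> (Cmod (Phi z - z) <= 1 / 2)%R) /\
  (forall z : C, (X <= Re z)%R -> Phi z = F (Phi (z + 1))) /\
  (forall z : C, (X < Re z)%R -> exists l, is_cderive Phi z l) /\
  (forall z w : C, (X < Re z)%R -> (X < Re w)%R -> Phi z = Phi w -> z = w).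
Proof.
  set (Phi := fun z : C => epsilon (inhabits (RtoC 0))
    (fun l : C => forall n, (Cmod (conjugate_iterate n z - l) <= tail n)%R)).
  assert (HPhi : forall z : C, (X <= Re z)%R -> forall n, (Cmod (conjugate_iterate n z - Phi z) <= tail n)%R).
  { intros z Hz. apply epsilon_spec.
    apply (telescoping_limit (fun n => conjugate_iterate n z)); [|exact tail_lim].
    intros n. apply tail_step, Hz. }
  assert (Hnear : forall z : C, (X <= Re z)%R -> (Cmod (Phi z - z) <= 1 / 2)%R).
  { intros z Hz. apply (le_of_lim_0 tail); [exact tail_lim|]. intros n.
    assert (T := Cmod_minus_triangle (Phi z) (conjugate_iterate n z) z).
    rewrite (Cmod_minus_sym (Phi z) (conjugate_iterate n z)) in T.
    assert (H1 := HPhi z Hz n). assert (H2 := conjugate_iterate_half n z Hz). lra. }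
  exists Phi. split; [|split; [exact Hnear|split; [|split]]].
  - intros z Hz. apply filterlim_C_Cmod. intros eps He.
    destruct (proj1 (is_lim_seq_Reals tail 0) tail_lim eps He) as [N HN].
    exists N. intros n Hn. specialize (HN n Hn). unfold R_dist in HN.
    rewrite Rminus_0_r in HN. apply Rabs_def2 in HN.
    eapply Rle_lt_trans; [apply HPhi, Hz|lra].
  - intros z Hz.
    assert (Hz1 : (X <= Re (z + 1))%R) by (rewrite Re_plus_1; lra).
    assert (E : (Cmod (Phi z - F (Phi (z + 1)%C)) <= 0)%R).
    { apply (le_of_lim_0 (fun n => tail (S n) + (1 + 16 * A / X ^ 2) * tail n)%R).
      - replace (Finite 0) with (Rbar_plus 0 0) by (simpl; f_equal; ring).
        apply (is_lim_seq_plus _ _ 0 0).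
        + apply (is_lim_seq_incr_1 tail). exact tail_lim.
        + apply is_lim_seq_scal_0, tail_lim.
        + simpl. reflexivity.
      - intros n. rewrite Rplus_0_l.
        eapply Rle_trans; [apply (Cmod_minus_triangle _ (conjugate_iterate (S n) z))|].
        rewrite Cmod_minus_sym. apply Rplus_le_compat; [apply HPhi, Hz|].
        rewrite conjugate_iterate_S.
        set (p := conjugate_iterate n (z + 1)). set (q := Phi (z + 1)).
        assert (Hp : (X <= Re p)%R) by (apply Re_iterate; lra).
        assert (Hq : (X <= Re q)%R).
        { assert (H := Re_near q (z + 1)). rewrite Re_plus_1 in H.
          assert (H1 := Hnear (z + 1) Hz1). fold q in H1. lra. }
        assert (HL := defect_Lipschitz X p q (Rle_refl X) Hp Hq).
        assert (Hpq : (Cmod (p - q) <= tail n)%R) by (apply HPhi, Hz1).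
        replace (F p - F q) with ((F p - F q - (p - q)) + (p - q)) by ring.
        eapply Rle_trans; [apply Cmod_triangle|].
        set (k := (16 * A / X ^ 2)%R) in *.
        assert (Hk : (0 <= k)%R) by (apply Rle_mult_inv_pos; [lra|apply pow_lt; lra]). nra. }
    assert (E' : Phi z - F (Phi (z + 1)) = 0) by (apply Cmod_eq_0, Rle_antisym; [exact E|apply Cmod_ge_0]).
    replace (Phi z) with (Phi z - F (Phi (z + 1)) + F (Phi (z + 1))) by ring. rewrite E'. ring.
  - intros z Hz.
    assert (Hball : forall w : C, (Cmod (w - z) < Re z - X)%R -> (X <= Re w)%R).
    { intros w Hw. assert (H := Re_near w z). lra. }
    apply (telescoping_limit_derivable conjugate_iterate Phi tail z (Re z - X) (Cmod z + (Re z - X) + 1)).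
    + lra.
    + intros n w Hw. apply conjugate_iterate_derivable, Hball, Hw.
    + intros n w Hw. assert (H1 := conjugate_iterate_half n w (Hball w Hw)).
      assert (T1 := Cmod_triangle (conjugate_iterate n w - w) w).
      replace (conjugate_iterate n w - w + w) with (conjugate_iterate n w) in T1 by ring.
      assert (T2 := Cmod_triangle (w - z) z). replace (w - z + z) with w in T2 by ring. lra.
    + intros n w Hw. apply tail_step, Hball, Hw.
    + intros n w Hw. apply HPhi, Hball, Hw.
    + exact tail_lim.
  - intros z w Hz Hw E.
    assert (Hm : (X < Rmin (Re z) (Re w))%R) by (apply Rmin_glb_lt; assumption).
    set (x := Rmin (Re z) (Re w)) in *.
    assert (H : (Cmod (z - w) <= growth x * Cmod (z - w))%R).
    { apply (le_of_lim_0 (fun n => 2 * tail n)%R); [apply is_lim_seq_scal_0, tail_lim|]. intros n.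
      assert (H1 := conjugate_iterate_spread n z w ltac:(lra) ltac:(lra)). fold x in H1.
      assert (H2 := HPhi z ltac:(lra) n). assert (H3 := HPhi w ltac:(lra) n). rewrite <- E in H3.
      set (p := conjugate_iterate n z) in *. set (q := conjugate_iterate n w) in *.
      replace (z - w) with ((p - Phi z) - (q - Phi z) - (p - q - (z - w))) at 1 by ring.
      eapply Rle_trans; [apply Cmod_triangle_minus|].
      assert (T := Cmod_triangle_minus (p - Phi z) (q - Phi z)). lra. }
    assert (Hg : (growth x < 1)%R).
    { unfold growth. apply (Rmult_lt_reg_r (x - 1)); [lra|]. unfold Rdiv. rewrite Rmult_assoc, Rinv_l by lra. lra. }
    assert (HD := Cmod_ge_0 (z - w)).
    assert (E' : z - w = 0) by (apply Cmod_eq_0; nra).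
    replace z with (z - w + w) by ring. rewrite E'. ring.
Qed.
End Translation.

(** * The germ at infinity and the unstable manifold *)

Lemma Cinv_involutive (z : C) : / / z = z.
Proof.
  destruct (Req_EM_T (Cmod z) 0) as [E|E].
  - apply Cmod_eq_0 in E. subst z.
    assert (H : / RtoC 0 = 0) by (apply injective_projections; simpl; unfold Rdiv; ring).
    rewrite H. exact H.
  - field. intros ->. apply E, Cmod_0.
Qed.

(** The conjugate of [f] by the inversion [z |-> 1 / z]. *)
Definition at_infinity (f : C -> C) (z : C) : C := / f (/ z).

Lemma iter_at_infinity (f : C -> C) (k : nat) (z : C) :
  Nat.iter k f (/ z) = / Nat.iter k (at_infinity f) z.
Proof.
  induction k as [|k IH]; [reflexivity|].
  simpl. rewrite IH. unfold at_infinity at 2. rewrite Cinv_involutive. reflexivity.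
Qed.

Lemma phi_conjugate_iterate (f : C -> C) (n : nat) (z : C) : z <> 0 -> 1 + RtoC (INR n) * z <> 0 ->
  phi_ f n z = / conjugate_iterate (at_infinity f) n (/ z).
Proof.
  intros Hz Hn. unfold phi_, conjugate_iterate. rewrite <- iter_at_infinity. f_equal.
  field. split; assumption.
Qed.

(** The inversion maps the disk, whose boundary circle passes through 0, to a
    half-plane. *)
Lemma V_inv (eps : R) (z : C) : (0 < eps)%R -> V eps z -> z <> 0 /\ (1 / (2 * eps) < Re (/ z))%R.
Proof.
  intros He Hz. unfold V in Hz.
  assert (H : (Cmod (z - RtoC eps) ^ 2 < eps ^ 2)%R).
  { simpl. rewrite !Rmult_1_r. assert (H := Cmod_ge_0 (z - RtoC eps)).
    apply Rmult_le_0_lt_compat; assumption. }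
  rewrite Cmod2_alt in H. destruct z as [x y]. simpl in H.
  assert (Hn : (0 < x ^ 2 + y ^ 2 < 2 * eps * x)%R).
  { split; [|simpl; lra]. assert (0 < x)%R by nra. nra. }
  split.
  - intros E. injection E as -> ->. simpl in Hn. lra.
  - simpl Re. simpl fst. apply (Rmult_lt_reg_r (2 * eps * (x ^ 2 + y ^ 2))).
    { apply Rmult_lt_0_compat; lra. }
    replace (1 / (2 * eps) * (2 * eps * (x ^ 2 + y ^ 2)))%R with (x ^ 2 + y ^ 2)%R by (field; lra).
    match goal with |- (_ < ?a * _)%R => replace (a * (2 * eps * (x ^ 2 + y ^ 2)))%R with (2 * eps * x)%R end.
    { lra. }
    simpl. field. simpl in Hn. lra.
Qed.

Section Germ.
Variables (f : C -> C) (r M : R).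
Hypothesis Hr : (0 < r <= 1)%R.
Hypothesis HM : (0 <= M)%R.
Hypothesis f_derivable : forall z : C, (Cmod z < r)%R -> exists l, is_cderive f z l.
Hypothesis f_expansion : forall z : C, (Cmod z < r)%R ->
  (Cmod (f z - (z + z ^ 2 + z ^ 3)) <= M * Cmod z ^ 4)%R.

Lemma germ_fixes_0 : f 0 = 0.
Proof.
  assert (H := f_expansion 0). rewrite Cmod_0 in H. specialize (H (proj1 Hr)).
  replace (f 0 - (0 + 0 ^ 2 + 0 ^ 3)) with (f 0) in H by ring.
  replace (M * 0 ^ 4)%R with 0%R in H by ring.
  apply Cmod_eq_0, Rle_antisym; [exact H|apply Cmod_ge_0].
Qed.

Lemma germ_quadratic (z : C) : (Cmod z < r)%R -> (Cmod (f z - z) <= (2 + M) * Cmod z ^ 2)%R.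
Proof.
  intros Hz. assert (H := f_expansion z Hz).
  replace (f z - z) with ((f z - (z + z ^ 2 + z ^ 3)) + (z ^ 2 + z ^ 3)) by ring.
  eapply Rle_trans; [apply Cmod_triangle|].
  assert (T := Cmod_triangle (z ^ 2) (z ^ 3)). rewrite !Cmod_pow in T.
  set (s := Cmod z) in *. assert (Hs : (0 <= s)%R) by apply Cmod_ge_0.
  assert (H3 : (s ^ 3 <= s ^ 2)%R) by (assert (0 <= s ^ 2)%R by (apply pow_le; exact Hs); simpl in *; nra).
  assert (H4 : (s ^ 4 <= s ^ 2)%R).
  { replace (s ^ 4)%R with (s ^ 2 * s ^ 2)%R by ring.
    assert (0 <= s ^ 2)%R by (apply pow_le; exact Hs). assert (s ^ 2 <= 1)%R by (simpl; nra). nra. }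
  assert (M * s ^ 4 <= M * s ^ 2)%R by (apply Rmult_le_compat_l; assumption). lra.
Qed.

(** The function [f z - z] is of size [O(t^2)] on the disk of radius [t], so its
    Lipschitz constant on half that disk is [O(t)] by Cauchy's estimate. *)
Lemma germ_near_identity : exists s, (0 < s <= r)%R /\
  forall z w : C, (Cmod z < s)%R -> (Cmod w < s)%R ->
  (Cmod ((f z - z) - (f w - w)) <= 1 / 2 * Cmod (z - w))%R.
Proof.
  set (t := Rmin r (/ (16 * (2 + M)))).
  assert (Ht1 : (t <= r)%R) by apply Rmin_l.
  assert (Ht2 : (t <= / (16 * (2 + M)))%R) by apply Rmin_r.
  assert (Ht0 : (0 < t)%R) by (apply Rmin_pos; [lra|apply Rinv_0_lt_compat; lra]).
  exists (t / 2)%R. split; [lra|]. intros z w Hz Hw.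
  eapply Rle_trans.
  - apply (Cauchy_Lipschitz (fun s => f s - s) 0 t ((2 + M) * t ^ 2) Ht0).
    + intros s Hs. replace (s - 0) with s in Hs by ring.
      destruct (f_derivable s) as [l Hl]; [lra|].
      eexists. apply is_cderive_minus; [exact Hl|apply is_cderive_id].
    + intros s Hs. replace (s - 0) with s in Hs by ring.
      eapply Rle_trans; [apply germ_quadratic; lra|].
      apply Rmult_le_compat_l; [lra|]. apply pow_incr. split; [apply Cmod_ge_0|lra].
    + replace (z - 0) with z by ring. exact Hz.
    + replace (w - 0) with w by ring. exact Hw.
  - apply Rmult_le_compat_r; [apply Cmod_ge_0|].
    replace (8 * ((2 + M) * t ^ 2) / t)%R with (8 * (2 + M) * t)%R by (field; lra).
    apply (Rmult_le_compat_l (8 * (2 + M))) in Ht2; [|lra].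
    replace (8 * (2 + M) * / (16 * (2 + M)))%R with (1 / 2)%R in Ht2 by (field; lra). exact Ht2.
Qed.

(** Chosen so that [1 / z] lies in the domain of [f] and [f (1 / z)] is at least
    half as large as [1 / z], in particular nonzero. *)
Let X0 : R := (/ r + 2 * (2 + M))%R.

Let inv_small (z : C) : (X0 < Re z)%R ->
  z <> 0 /\ (Cmod (/ z) < r)%R /\ ((2 + M) * Cmod (/ z) <= 1 / 2)%R /\ (0 < Cmod (/ z))%R.
Proof.
  intros Hz. assert (H := Re_le_Cmod z).
  assert (Hi : (0 < / r)%R) by (apply Rinv_0_lt_compat; lra).
  assert (Hz0 : z <> 0) by (apply Cmod_gt_0; unfold X0 in Hz; lra).
  rewrite Cmod_inv by exact Hz0. unfold X0 in Hz.
  assert (Hp : (0 < Cmod z)%R) by lra.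
  repeat split; [exact Hz0| | |apply Rinv_0_lt_compat; exact Hp].
  - rewrite <- (Rinv_inv r). apply Rinv_lt_contravar; [apply Rmult_lt_0_compat; assumption|lra].
  - apply (Rmult_le_reg_r (Cmod z)); [exact Hp|]. rewrite Rmult_assoc, Rinv_l by lra. lra.
Qed.

Let f_nonzero (z : C) : (0 < Cmod z < r)%R -> ((2 + M) * Cmod z <= 1 / 2)%R -> (Cmod z / 2 <= Cmod (f z))%R.
Proof.
  intros Hz Hs. assert (H := germ_quadratic z (proj2 Hz)).
  assert (T := Cmod_triangle_minus (f z) (f z - z)). replace (f z - (f z - z)) with z in T by ring.
  replace ((2 + M) * Cmod z ^ 2)%R with ((2 + M) * Cmod z * Cmod z)%R in H by ring.
  assert ((2 + M) * Cmod z * Cmod z <= 1 / 2 * Cmod z)%R by (apply Rmult_le_compat_r; lra). lra.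
Qed.

(** With [s = 1 / z] and [e] the remainder of the expansion of [f] at [s], the
    defect [1 / f s - 1 / s + 1] equals [(s^4 + (s - 1) * e) / (s * f s)]: the terms
    in [s^2] and [s^3] of the numerator cancel. *)
Lemma germ_at_infinity : exists X0 A : R, (/ r <= X0 /\ 0 <= A)%R /\
  (forall z : C, (X0 < Re z)%R -> exists l, is_cderive (at_infinity f) z l) /\
  (forall z : C, (X0 < Re z)%R -> (Cmod (at_infinity f z - (z - 1)) <= A / Cmod z ^ 2)%R).
Proof.
  exists X0, (2 * (1 + 2 * M))%R. split; [unfold X0; lra|]. split.
  - intros z Hz. destruct (inv_small z Hz) as (Hz0 & Hzr & Hzs & Hzp).
    destruct (f_derivable (/ z) Hzr) as [l Hl].
    assert (Hf0 : f (/ z) <> 0).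
    { apply Cmod_gt_0. assert (H := f_nonzero (/ z) ltac:(lra) Hzs). lra. }
    eexists. apply (is_cderive_comp Cinv (fun w => f (/ w))).
    + apply is_cderive_inv, Hf0.
    + apply (is_cderive_comp f Cinv); [exact Hl|apply is_cderive_inv, Hz0].
  - intros z Hz. destruct (inv_small z Hz) as (Hz0 & Hzr & Hzs & Hzp).
    set (s := / z) in *.
    assert (Hn := f_nonzero s ltac:(lra) Hzs).
    assert (Hf0 : f s <> 0) by (apply Cmod_gt_0; lra).
    assert (Hs0 : s <> 0) by (apply Cmod_gt_0; exact Hzp).
    assert (Ez : z = / s) by (unfold s; rewrite Cinv_involutive; reflexivity).
    set (e := f s - (s + s ^ 2 + s ^ 3)).
    assert (He : (Cmod e <= M * Cmod s ^ 4)%R) by (apply f_expansion, Hzr).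
    unfold at_infinity. fold s. rewrite Ez.
    replace (/ f s - (/ s - 1)) with ((s ^ 4 + (s - 1) * e) * / (s * f s)).
    2:{ unfold e. field. split; assumption. }
    rewrite Cmod_mult, !Cmod_inv, Cmod_mult by (try apply Cmult_neq_0; assumption).
    assert (T1 := Cmod_triangle (s ^ 4) ((s - 1) * e)). rewrite Cmod_mult, Cmod_pow in T1.
    assert (T2 := Cmod_triangle_minus s 1). rewrite Cmod_1 in T2.
    set (n := Cmod s) in *.
    assert (T3 : (Cmod (s - 1) * Cmod e <= 2 * (M * n ^ 4))%R).
    { apply Rmult_le_compat; try apply Cmod_ge_0; lra. }
    apply Rle_trans with ((1 + 2 * M) * n ^ 4 * / (n * (n / 2)))%R.
    + apply Rmult_le_compat.
      * apply Cmod_ge_0.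
      * left. apply Rinv_0_lt_compat, Rmult_lt_0_compat; lra.
      * lra.
      * apply Rinv_le_contravar; [apply Rmult_lt_0_compat; lra|]. apply Rmult_le_compat_l; lra.
    + right. field. lra.
Qed.
End Germ.

Theorem theorem2p1 (U : C -> Prop) (f : C -> C)
    (U_open : open U) (U_0 : U (RtoC 0))
    (f_hol : holomorphic_on U f)
    (f_exp : exists M : R, locally (RtoC 0) (fun z : C =>
       (Cmod (f z - (z + z ^ 2 + z ^ 3))%C <= M * Cmod z ^ 4)%R)) :
  (exists (W : C -> Prop) (g : C -> C), local_inverse U f W g) /\
  forall (W : C -> Prop) (g : C -> C), local_inverse U f W g ->
  exists eps0 : R, (0 < eps0)%R /\
  forall eps : R, (0 < eps < eps0)%R ->
    (forall (n : nat) (z : C), V eps z -> phi_defined_at U f n z) /\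
    (exists phi : C -> C,
       (forall z : C, V eps z ->
          filterlim (fun n : nat => phi_ f n z) eventually (locally (phi z))) /\
       unstable_parametrization U f W g eps phi /\
       (forall t : C, V eps t -> V eps (t / (1 - t))%C ->
          phi (t / (1 - t))%C = f (phi t))) /\
    (exists C' : R, (0 < C')%R /\
       forall (z : C) (n : nat), V eps z -> (1 <= n)%nat ->
         (Cmod (phi_ f (S n) z - phi_ f n z)%C
            < C' * Cmod z ^ 2 / (1 + INR n * Cmod z) ^ 2)%R /\
         (C' * Cmod z ^ 2 / (1 + INR n * Cmod z) ^ 2 < C' / INR n ^ 2)%R).
Proof.
  assert (Hdata : exists r M : R, (0 < r <= 1)%R /\ (0 <= M)%R /\
    (forall z : C, (Cmod z < r)%R -> U z) /\
    (forall z : C, (Cmod z < r)%R -> (Cmod (f z - (z + z ^ 2 + z ^ 3)) <= M * Cmod z ^ 4)%R)).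
  { destruct f_exp as [M HM]. apply locally_C_Cmod in HM. destruct HM as [d1 [Hd1 HM]].
    assert (HU := U_open (RtoC 0) U_0). apply locally_C_Cmod in HU. destruct HU as [d2 [Hd2 HU]].
    assert (H1 := Rmin_l (Rmin d1 d2) 1). assert (H2 := Rmin_r (Rmin d1 d2) 1).
    assert (H3 := Rmin_l d1 d2). assert (H4 := Rmin_r d1 d2).
    exists (Rmin (Rmin d1 d2) 1), (Rabs M).
    split; [split; [repeat apply Rmin_pos; lra|exact H2]|].
    split; [apply Rabs_pos|]. split; intros z Hz.
    - apply HU. replace (z - 0) with z by ring. lra.
    - eapply Rle_trans; [apply HM; replace (z - 0) with z by ring; lra|].
      apply Rmult_le_compat_r; [apply pow_le, Cmod_ge_0|apply Rle_abs]. }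
  destruct Hdata as (r & M & Hr & HM & HU & Hexp).
  assert (Hder : forall z : C, (Cmod z < r)%R -> exists l, is_cderive f z l).
  { intros z Hz. apply (proj1 (holomorphic_on_is_cderive U f) f_hol), HU, Hz. }
  split.
  { destruct (germ_near_identity f r M Hr HM Hder Hexp) as [s [Hs Hlip]].
    apply (local_inverse_exists U f s); try assumption; try lra.
    - intros z Hz. apply HU. lra.
    - apply (germ_fixes_0 f r M); assumption. }
  intros W g [W_open W_0 _ _ _ g_left].
  assert (HW := W_open (RtoC 0) W_0). apply locally_C_Cmod in HW. destruct HW as [d1 [Hd1 HW]].
  apply locally_C_Cmod in g_left. destruct g_left as [d2 [Hd2 Hg]].
  destruct (germ_at_infinity f r M Hr HM Hder Hexp) as (X0 & A & [HX0 HA] & HFd & HFt).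
  set (F := at_infinity f) in *.
  assert (Hi1 := Rinv_0_lt_compat _ Hd1). assert (Hi2 := Rinv_0_lt_compat _ Hd2).
  assert (Hir := Rinv_0_lt_compat _ (proj1 Hr)).
  (* Large enough for the half-plane estimates, and so that inverses of points of
     real part at least [X - 1] lie where [f] is defined, in [W], and where [g]
     inverts [f]. *)
  set (X := (X0 + 32 * A + / d1 + / d2 + 4)%R).
  assert (HX : (X0 + 2 <= X /\ 3 <= X /\ 32 * A <= X - 1)%R) by (unfold X; lra).
  assert (Hsmall : forall w : C, (X - 1 <= Re w)%R ->
    (1 <= Cmod w /\ w <> 0 /\ Cmod (/ w) < r /\ Cmod (/ w) < d1 /\ Cmod (/ w) < d2)%R).
  { intros w Hw. assert (H := Re_le_Cmod w). unfold X in Hw.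
    assert (Hw0 : w <> 0) by (apply Cmod_gt_0; lra).
    rewrite Cmod_inv by exact Hw0.
    assert (Hlt : forall d, (0 < d)%R -> (/ d < Cmod w)%R -> (/ Cmod w < d)%R).
    { intros d Hd Hdw. rewrite <- (Rinv_inv d). apply Rinv_lt_contravar; [|exact Hdw].
      apply Rmult_lt_0_compat; [apply Rinv_0_lt_compat; exact Hd|lra]. }
    split; [lra|]. split; [exact Hw0|]. repeat split; apply Hlt; lra. }
  destruct (conjugation_to_translation F X0 A X HA HFd HFt HX)
    as (Phi & Phi_lim & Phi_near & Phi_eq & Phi_der & Phi_inj).
  assert (Phi_Re : forall w : C, (X <= Re w)%R -> (X - 1 <= Re (Phi w))%R).
  { intros w Hw. assert (H := Re_near (Phi w) w). assert (H1 := Phi_near w Hw). lra. }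
  assert (it_Re : forall n (w : C), (X <= Re w)%R -> (X - 1 <= Re (conjugate_iterate F n w))%R).
  { intros n w Hw. assert (H := Re_near (conjugate_iterate F n w) w).
    assert (H1 := conjugate_iterate_half F X0 A X HA HFt HX n w Hw). lra. }
  assert (Hinv_diff : forall p q : C, (X - 1 <= Re p)%R -> (X - 1 <= Re q)%R ->
    (Cmod (/ p - / q) <= Cmod (p - q))%R).
  { intros p q Hp Hq. destruct (Hsmall p Hp) as (Hp1 & Hp0 & _). destruct (Hsmall q Hq) as (Hq1 & Hq0 & _).
    replace (/ p - / q) with ((q - p) * / (p * q)) by (field; split; assumption).
    rewrite Cmod_mult, Cmod_inv, Cmod_mult, (Cmod_minus_sym q p) by (apply Cmult_neq_0; assumption).
    rewrite <- (Rmult_1_r (Cmod (p - q))) at 2. apply Rmult_le_compat_l; [apply Cmod_ge_0|].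
    rewrite <- Rinv_1. apply Rinv_le_contravar; [lra|]. nra. }
  exists (1 / (2 * X))%R. split; [apply Rdiv_lt_0_compat; lra|].
  intros eps [He He0].
  assert (HXe : (X < 1 / (2 * eps))%R).
  { apply (Rmult_lt_reg_r (2 * eps)); [lra|]. replace (1 / (2 * eps) * (2 * eps))%R with 1%R by (field; lra).
    apply (Rmult_lt_compat_r (2 * X)) in He0; [|lra].
    replace (1 / (2 * X) * (2 * X))%R with 1%R in He0 by (field; lra). lra. }
  assert (HV : forall z : C, V eps z -> z <> 0 /\ (X < Re (/ z))%R).
  { intros z Hz. destruct (V_inv eps z He Hz) as [H1 H2]. split; [exact H1|lra]. }
  assert (Hden : forall n (z : C), V eps z -> 1 + RtoC (INR n) * z <> 0).
  { intros n z Hz H. destruct (HV z Hz) as [Hz0 HzX].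
    assert (E : / z + RtoC (INR n) = 0).
    { replace (/ z + RtoC (INR n)) with ((1 + RtoC (INR n) * z) * / z) by (field; exact Hz0).
      rewrite H. ring. }
    apply (f_equal Re) in E.
    change (Re (/ z + RtoC (INR n))) with (Re (/ z) + INR n)%R in E. simpl (Re 0) in E.
    assert (Hn := pos_INR n). lra. }
  assert (Hphi : forall n (z : C), V eps z -> phi_ f n z = / conjugate_iterate F n (/ z)).
  { intros n z Hz. apply phi_conjugate_iterate; [apply (HV z Hz)|apply Hden, Hz]. }
  split; [|split].
  - intros n z Hz. split; [apply Hden, Hz|]. intros k Hk.
    destruct (HV z Hz) as [Hz0 HzX].
    (* The [k]-th point of the orbit is [conjugate_iterate] of rank [k], based [n - k]
       units further to the right. *)
    replace (z / (1 + RtoC (INR n) * z)) with (/ ((/ z + RtoC (INR (n - k))) + RtoC (INR k))).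
    2:{ rewrite minus_INR, RtoC_minus by lia. 
        replace (/ z + (RtoC (INR n) - RtoC (INR k)) + RtoC (INR k)) with ((1 + RtoC (INR n) * z) / z) by (field; exact Hz0).
        field. split; [apply Hden, Hz|exact Hz0]. }
    rewrite iter_at_infinity. apply HU.
    apply (Hsmall (conjugate_iterate F k (/ z + RtoC (INR (n - k))))).
    apply it_Re. change (Re (/ z + RtoC (INR (n - k)))) with (Re (/ z) + INR (n - k))%R.
    assert (Hn := pos_INR (n - k)). lra.
  - set (phi := fun z : C => / Phi (/ z)). exists phi.
    assert (Hconj : forall t : C, V eps t -> V eps (t / (1 - t)) ->
       U (phi t) /\ phi (t / (1 - t)) = f (phi t)).
    { intros t Ht Ht'. destruct (HV t Ht) as [Ht0 HtX]. destruct (HV _ Ht') as [Ht0' HtX'].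
      split; [apply HU, (Hsmall (Phi (/ t))), Phi_Re; lra|].
      assert (E1 : 1 - t <> 0).
      { intros E. apply Ht0'. rewrite E. apply injective_projections; simpl; unfold Rdiv; ring. }
      assert (E : / (t / (1 - t)) = / t - 1) by (field; split; assumption).
      unfold phi. rewrite E in *. rewrite (Phi_eq (/ t - 1)) by lra.
      replace (/ t - 1 + 1) with (/ t) by ring.
      unfold F, at_infinity. rewrite Cinv_involutive. reflexivity. }
    split; [|split; [split|]].
    + intros z Hz. destruct (HV z Hz) as [Hz0 HzX].
      assert (HL := Phi_lim (/ z) ltac:(lra)). rewrite filterlim_C_Cmod in HL.
      apply filterlim_C_Cmod. intros e He'. destruct (HL e He') as [N HN].
      exists N. intros n Hn. rewrite (Hphi n z Hz).
      eapply Rle_lt_trans; [|apply (HN n Hn)].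
      apply Hinv_diff; [apply it_Re|apply Phi_Re]; lra.
    + apply holomorphic_on_is_cderive. intros z Hz. destruct (HV z Hz) as [Hz0 HzX].
      destruct (Phi_der (/ z) HzX) as [l Hl].
      eexists. apply (is_cderive_comp Cinv (fun w => Phi (/ w))).
      * apply is_cderive_inv. apply (Hsmall (Phi (/ z))), Phi_Re; lra.
      * apply (is_cderive_comp Phi Cinv); [exact Hl|apply is_cderive_inv, Hz0].
    + intros s t Hs Ht E. destruct (HV s Hs) as [Hs0 HsX]. destruct (HV t Ht) as [Ht0 HtX].
      apply (f_equal Cinv) in E. unfold phi in E. rewrite !Cinv_involutive in E.
      apply Phi_inj in E; [|assumption|assumption].
      rewrite <- (Cinv_involutive s), E. apply Cinv_involutive.
    + intros t Ht. destruct (HV t Ht) as [Ht0 HtX].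
      assert (HRe : forall n, (X + INR n <= Re (/ t + RtoC (INR n)))%R).
      { intros n. change (Re (/ t + RtoC (INR n))) with (Re (/ t) + INR n)%R. lra. }
      assert (HX' : forall n, (X <= Re (/ t + RtoC (INR n)))%R).
      { intros n. specialize (HRe n). assert (Hn := pos_INR n). lra. }
      assert (Horbit : forall n, Nat.iter n g (phi t) = / Phi (/ t + RtoC (INR n))).
      { induction n as [|n IH].
        - simpl. unfold phi. do 2 f_equal. ring.
        - simpl Nat.iter. rewrite IH, Phi_eq by apply HX'.
          replace (/ t + RtoC (INR n) + 1) with (/ t + RtoC (INR (S n))) by (rewrite S_INR, RtoC_plus; ring).
          unfold F, at_infinity. rewrite Cinv_involutive. apply Hg.
          replace (/ Phi (/ t + RtoC (INR (S n))) - 0) with (/ Phi (/ t + RtoC (INR (S n)))) by ring.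
          apply (Hsmall (Phi (/ t + RtoC (INR (S n))))), Phi_Re, HX'. }
      split.
      * intros n. rewrite Horbit. apply HW.
        replace (/ Phi (/ t + RtoC (INR n)) - 0) with (/ Phi (/ t + RtoC (INR n))) by ring.
        apply (Hsmall (Phi (/ t + RtoC (INR n)))), Phi_Re, HX'.
      * apply filterlim_C_Cmod. intros e He'.
        destruct (INR_unbounded (/ e)) as [N HN]. exists N. intros n Hn.
        rewrite Horbit. replace (/ Phi (/ t + RtoC (INR n)) - 0) with (/ Phi (/ t + RtoC (INR n))) by ring.
        destruct (Hsmall _ (Phi_Re _ (HX' n))) as (_ & H0 & _). rewrite Cmod_inv by exact H0.
        assert (HnN := le_INR _ _ Hn). specialize (HRe n).
        assert (H1 := Re_near (Phi (/ t + RtoC (INR n))) (/ t + RtoC (INR n))).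
        assert (H2 := Phi_near _ (HX' n)).
        assert (H3 := Re_le_Cmod (Phi (/ t + RtoC (INR n)))).
        assert (Hie := Rinv_0_lt_compat _ He').
        rewrite <- (Rinv_inv e). apply Rinv_lt_contravar; [apply Rmult_lt_0_compat|]; lra.
    + exact Hconj.
    + intros t Ht Ht'. apply Hconj; assumption.
  - (* The step bound gives [2 * A / |1/z + n + 1|^2], and [|1/z| + n] is at most
       twice [|1/z + n + 1|] because [Re (1/z) > 0]; the added 1 makes the
       inequality strict. *)
    exists (8 * A + 1)%R. split; [lra|]. intros z n Hz Hn.
    destruct (HV z Hz) as [Hz0 HzX].
    assert (Hzp := proj1 (Cmod_gt_0 z) Hz0).
    assert (Hn1 : (1 <= INR n)%R) by (apply (le_INR 1), Hn).
    set (c := Cmod (/ z)).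
    assert (Hc : Cmod z = (/ c)%R) by (unfold c; rewrite Cmod_inv by exact Hz0; rewrite Rinv_inv; reflexivity).
    assert (Hcp : (0 < c)%R) by (unfold c; rewrite Cmod_inv by exact Hz0; apply Rinv_0_lt_compat, Hzp).
    replace ((8 * A + 1) * Cmod z ^ 2 / (1 + INR n * Cmod z) ^ 2)%R with ((8 * A + 1) * / (c + INR n) ^ 2)%R.
    2:{ rewrite Hc. field. repeat split; lra. }
    split.
    + rewrite !Hphi by exact Hz.
      eapply Rle_lt_trans; [apply Hinv_diff; apply it_Re; lra|].
      eapply Rle_lt_trans; [apply (conjugate_iterate_step F X0 A X HA HFd HFt HX n (/ z)); lra|].
      set (q := / z + RtoC (INR n + 1)).
      assert (Hq1 : (INR n <= Cmod q)%R).
      { assert (H := Re_le_Cmod q). change (Re q) with (Re (/ z) + (INR n + 1))%R in H. lra. }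
      assert (Hq2 : (c <= Cmod q)%R).
      { apply Rsqr_incr_0_var; [|apply Cmod_ge_0]. unfold Rsqr.
        replace (c * c)%R with (Cmod (/ z) ^ 2)%R by (unfold c; ring).
        replace (Cmod q * Cmod q)%R with (Cmod q ^ 2)%R by ring.
        rewrite !Cmod2_alt. change (Re q) with (Re (/ z) + (INR n + 1))%R.
        replace (Im q) with (Im (/ z)) by (unfold q; simpl; ring). nra. }
      assert (Hsum : (0 < c + INR n <= 2 * Cmod q)%R) by lra.
      assert (Hinv : (/ Cmod q ^ 2 <= 4 * / (c + INR n) ^ 2)%R).
      { apply Rinv_le_mult; [apply pow_lt; lra|].
        apply (Rmult_le_reg_r ((c + INR n) ^ 2)); [apply pow_lt; lra|].
        replace (4 * / (c + INR n) ^ 2 * Cmod q ^ 2 * (c + INR n) ^ 2)%R with ((2 * Cmod q) ^ 2)%R by (field; lra).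
        rewrite Rmult_1_l. apply pow_incr. lra. }
      assert (Hip : (0 < / (c + INR n) ^ 2)%R) by (apply Rinv_0_lt_compat, pow_lt; lra).
      unfold Rdiv. nra.
    + unfold Rdiv. apply Rmult_lt_compat_l; [lra|].
      apply Rinv_lt_contravar; [apply Rmult_lt_0_compat; apply pow_lt; lra|].
      simpl. nra.
Qed.
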